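(* Let $E=A\#_fH$ be a crossed product. With the maps $\phi_*:X_*\to B_*(E)$, $\psi_*:B_*(E)\to X_*$ and $\omega_{*+1}:B_*(E)\to B_{*+1}(E)$ and the filtrations $F^0\subseteq F^1\subseteq\cdots$ of $X_*$ and of $B_*(E)$ defined in the context, the maps $\phi_*$, $\psi_*$ and $\omega_{*+1}$ preserve filtrations; that is, $\phi_n(F^i(X_n))\subseteq F^i(B_n(E))$, $\psi_n(F^i(B_n(E)))\subseteq F^i(X_n)$ and $\omega_{n+1}(F^i(B_n(E)))\subseteq F^i(B_{n+1}(E))$ for all $i,n\ge0$.
   Context: $k$ is a commutative ring with unit, $\otimes=\otimes_k$, $H$ is a Hopf algebra with counit $\epsilon$ and Sweedler notation $\Delta(h)=h^{(1)}\otimes h^{(2)}$ (sum understood), $A$ is a $k$-algebra. A weak action of $H$ on $A$ is a bilinear map $(h,a)\mapsto a^h$, $H\times A\to A$, with $(ab)^h=a^{h^{(1)}}b^{h^{(2)}}$, $1^h=\epsilon(h)1$, $a^1=a$. Given a weak action and a $k$-linear map $f:H\otimes H\to A$, $A\#_fH$ is $A\otimes H$ (elements written $a\#h$) with product $(a\#h)(b\#l)=ab^{h^{(1)}}f(h^{(2)},l^{(1)})\#h^{(3)}l^{(2)}$; it is called a crossed product if it is associative with unit $1\#1$, equivalently: $f(h,1)=f(1,h)=\epsilon(h)1_A$; $f(l^{(1)},m^{(1)})^{h^{(1)}}f(h^{(2)},l^{(2)}m^{(2)})=f(h^{(1)},l^{(1)})f(h^{(2)}l^{(2)},m)$; and $(a^{l^{(1)}})^{h^{(1)}}f(h^{(2)},l^{(2)})=f(h^{(1)},l^{(1)})a^{h^{(2)}l^{(2)}}$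 for all $h,l,m\in H$, $a\in A$. $A$ is regarded as the subalgebra $A\#1$ of $E$. Notation: $\overline B=B/k$ for a $k$-algebra $B$ (classes denoted by the same letter), $\overline B^l=\overline B\otimes\cdots\otimes\overline B$ ($l$ times). $\mathbf h_{ij}=h_i\otimes\cdots\otimes h_j$, $\mathbf a_{ij}=a_i\otimes\cdots\otimes a_j$. For $\mathbf h=h_i\otimes\cdots\otimes h_j$, $\mathbf h^{(1)}\otimes\mathbf h^{(2)}=(h_i^{(1)}\otimes\cdots\otimes h_j^{(1)})\otimes(h_i^{(2)}\otimes\cdots\otimes h_j^{(2)})$, and $a^{\overline{\mathbf h}}=(\cdots((a^{h_j})^{h_{j-1}})\cdots)^{h_i}$ for $a\in A$. ''$\otimes k$'' at the end of a tensor product denotes the elements whose last factor is a multiple of $1_E$. The complex $(X_*,d_* )$. $X_{rs}=E\otimes\overline H^s\otimes\overline A^r\otimes E$ ($r,s\ge0$), an $E$-bimodule by multiplication on the outer factors. Elements are written $a_0\otimes\mathbf h_{0s}\otimes\mathbf a\otimes h_{s+1}$ with $\mathbf a=a_1\otimes\cdots\otimes a_{r+1}$, where the left factor $E$ contains $a_0\#h_0$ and the right factor $E$ contains $a_{r+1}\#h_{s+1}$. $Y_s=E\otimes\overline H^s\otimes H$, with elements $a_0\otimes\mathbf h$, $\mathbf h=h_0\otimes\cdots\otimes h_{s+1}$; left action canonical, right action $(a_0\otimes\mathbf h)(a\#h)=a_0a^{\overline{\mathbf h^{(1)}}}f(h_{s+1}^{(2)},h^{(1)})^{\overline{\mathbf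 h_{0s}^{(2)}}}\otimes(\mathbf h_{0s}^{(3)}\otimes h_{s+1}^{(3)}h^{(2)})$. Bimodule maps $\mu_s:X_{0s}\to Y_s$, $d^0_{rs}:X_{rs}\to X_{r-1,s}$, $\partial_s:Y_s\to Y_{s-1}$: $\mu_s(a_0\otimes\mathbf h_{0s}\otimes a_1\otimes h_{s+1})=a_0a_1^{\overline{\mathbf h_{0s}^{(1)}}}\otimes\mathbf h_{0s}^{(2)}\otimes h_{s+1}$; $d^0_{rs}(a_0\otimes\mathbf h_{0s}\otimes\mathbf a\otimes h_{s+1})=a_0a_1^{\overline{\mathbf h_{0s}^{(1)}}}\otimes\mathbf h_{0s}^{(2)}\otimes\mathbf a_{2,r+1}\otimes h_{s+1}+\sum_{i=1}^r(-1)^ia_0\otimes\mathbf h_{0s}\otimes\mathbf a_{1,i-1}\otimes a_ia_{i+1}\otimes\mathbf a_{i+2,r+1}\otimes h_{s+1}$; $\partial_s(a\otimes\mathbf h)=\sum_{i=0}^s(-1)^{i+1}af(h_i^{(1)},h_{i+1}^{(1)})^{\overline{\mathbf h_{0,i-1}^{(1)}}}\otimes\mathbf h_{0,i-1}^{(2)}\otimes h_i^{(2)}h_{i+1}^{(2)}\otimes\mathbf h_{i+2,s+1}$. Left $E$-module maps $\sigma^0_{0s}:Y_s\to X_{0s}$, $\sigma^0_{r+1,s}:X_{rs}\to X_{r+1,s}$ ($r\ge0$): $\sigma^0_{r+1,s}(a_0\otimes\mathbf h_{0s}\otimes\mathbf a\otimes h_{s+1})=(-1)^{r+1}a_0\otimes\mathbf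 h_{0s}\otimes\mathbf a\otimes1\#h_{s+1}$ for $r\ge-1$ (no $\mathbf a$ if $r=-1$). Bimodule maps $d^l_{rs}:X_{rs}\to X_{r+l-1,s-l}$ ($r\ge0$, $1\le l\le s$), recursively, on $\mathbf x\in k\otimes\overline H^s\otimes\overline A^r\otimes k$: $d^1_{0s}(\mathbf x)=-\sigma^0_{0,s-1}\partial_s\mu_s(\mathbf x)$; $d^l_{0s}(\mathbf x)=-\sum_{j=1}^{l-1}\sigma^0_{l-1,s-l}d^{l-j}_{j-1,s-j}d^j_{0s}(\mathbf x)$ for $1<l\le s$; $d^l_{rs}(\mathbf x)=-\sum_{j=0}^{l-1}\sigma^0_{r+l-1,s-l}d^{l-j}_{r+j-1,s-j}d^j_{rs}(\mathbf x)$ for $r>0$. $X_n=\bigoplus_{r+s=n}X_{rs}$, $d_n=\sum_{r+s=n}\sum_{0\le l\le s,\,r+l>0}d^l_{rs}$. The contracting homotopy $\overline\sigma_*$. $\sigma^{-1}_0:E\to Y_0$, $\sigma^{-1}_{s+1}:Y_s\to Y_{s+1}$ are $\sigma^{-1}_{s+1}(x)=(-1)^sx\otimes1_H$ ($s\ge-1$). Writing $\sigma^l_{l,s-l}:Y_s\to X_{l,s-l}$ (case $r=-1$) and $\sigma^l_{r+l+1,s-l}:X_{rs}\to X_{r+l+1,s-l}$ ($r\ge0$), put $\sigma^l_{r+l+1,s-l}=-\sum_{i=0}^{l-1}\sigma^0_{r+l+1,s-l}\,d^{l-i}_{r+i+1,s-i}\,\sigma^i_{r+i+1,s-i}$ for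 $0<l\le s$, $r\ge-1$. Then $\overline\sigma_0=\sigma^0_{00}\sigma^{-1}_0$ and $\overline\sigma_{n+1}=-\sum_{l=0}^{n+1}\sigma^l_{l,n-l+1}\,\sigma^{-1}_{n+1}\,\mu_n+\sum_{r+s=n,\ r\ge 0}\sum_{l=0}^s\sigma^l_{r+l+1,s-l}:X_n\to X_{n+1}$ ($n\ge0$; $\mu_n$ is extended by $0$ on $X_{r,n-r}$, $r>0$). The Hochschild resolution. $B_n(E)=E\otimes\overline E^n\otimes E$, $b'_n(x_0\otimes\cdots\otimes x_{n+1})=\sum_{i=0}^n(-1)^ix_0\otimes\cdots\otimes x_ix_{i+1}\otimes\cdots\otimes x_{n+1}$, and $\xi_n(\mathbf x)=(-1)^n\mathbf x\otimes1$, $\xi_n:B_{n-1}(E)\to B_n(E)$. The $E$-bimodule maps $\phi_n:X_n\to B_n(E)$, $\psi_n:B_n(E)\to X_n$, $\omega_{n+1}:B_n(E)\to B_{n+1}(E)$ are defined by $\phi_0=\mathrm{id}$, $\psi_0=\mathrm{id}$, $\omega_1=0$, $\phi_{n+1}(\mathbf x\otimes1)=\xi_{n+1}\phi_nd_{n+1}(\mathbf x\otimes1)$, $\psi_{n+1}(\mathbf y\otimes1)=\overline\sigma_{n+1}\psi_nb'_{n+1}(\mathbf y\otimes1)$ for $\mathbf x\in E\otimes\overline H^s\otimes\overline A^r$ ($r+s=n+1$), $\mathbf y\in E\otimes\overline E^{n+1}$, and $\omega_{n+1}(\mathbf z)=\xi_{n+1}(\phi_n\psi_n-\mathrm{id}-\omega_nb'_n)(\mathbf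 z)$ for $\mathbf z\in E\otimes\overline E^n\otimes k$. Filtrations: $F^i(X_n)=\bigoplus_{0\le s\le i}E\otimes\overline H^s\otimes\overline A^{n-s}\otimes E$; $F^i(B_n(E))$ is the sub-bimodule of $B_n(E)$ generated by the tensors $1\otimes x_1\otimes\cdots\otimes x_n\otimes1$ such that at least $n-i$ of the $x_j$'s belong to $A$. *)

(* Defs.v *)
From HB Require Import structures.
From mathcomp Require Import all_boot all_algebra.
From mathcomp Require Import ring_quotient generic_quotient sesquilinear.
From mathcomp Require Import boolp.
From mathcomp.multinomials Require Import freeg.

Set Implicit Arguments.
Unset Strict Implicit.
Unset Printing Implicit Defensive.

Import GRing.Theory.
Local Open Scope ring_scope.
Local Open Scope quotient_scope.

Section Presented.
Context (k : comNzRingType) (W : choiceType) (Rel : {freeg W / k} -> Prop).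

Definition relspan (x : {freeg W / k}) : bool :=
  `[< exists s : seq (k * {freeg W / k}),
        (forall p, p \in s -> Rel p.2) /\ x = \sum_(p <- s) p.1 *: p.2 >].

Fact relspan_zmod : zmod_closed relspan.
Proof.
split; first by apply/asboolP; exists [::]; rewrite big_nil.
move=> x y /asboolP[s [sR ->]] /asboolP[t [tR ->]]; apply/asboolP.
exists (s ++ [seq (- p.1, p.2) | p <- t]); split=> [p|].
  by rewrite mem_cat => /orP[/sR //|/mapP[q /tR qR ->]].
rewrite big_cat big_map -sumrN; congr (_ + _).
by apply: eq_bigr => p _; rewrite scaleNr.
Qed.

HB.instance Definition _ :=
  GRing.isZmodClosed.Build {freeg W / k} relspan relspan_zmod.

Fact relspanZ (a : k) x : x \in relspan -> a *: x \in relspan.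
Proof.
move=> /asboolP[s [sR ->]]; apply/asboolP.
exists [seq (a * p.1, p.2) | p <- s]; split=> [p /mapP[q /sR qR ->] //|].
by rewrite big_map scaler_sumr; apply: eq_bigr => p _; rewrite scalerA.
Qed.

Local Notation QF := (Quotient.quot (GRing.ZmodClosed.clone _ relspan _)).

Definition pres := QF.
HB.instance Definition _ := GRing.Zmodule.on pres.

Definition pres_pi : {freeg W / k} -> pres := \pi_QF.
Definition pres_repr (x : pres) : {freeg W / k} := repr (x : QF).

Fact pres_reprK : cancel pres_repr pres_pi.
Proof. by move=> x; rewrite /pres_pi /pres_repr reprK. Qed.

Fact pres_piB : {morph pres_pi : x y / x - y}.
Proof. by move=> x y; rewrite /pres_pi !piE. Qed.

Fact pres_piD : {morph pres_pi : x y / x + y}.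
Proof. by move=> x y; rewrite /pres_pi !piE. Qed.

Fact pres_pi_eq x y : (pres_pi x == pres_pi y) = (x - y \in relspan).
Proof. by rewrite [LHS]piE Quotient.equivE. Qed.

Definition pres_scale (a : k) (x : pres) : pres := pres_pi (a *: pres_repr x).

Fact pres_scale_pi a x : pres_scale a (pres_pi x) = pres_pi (a *: x).
Proof.
apply/eqP; rewrite pres_pi_eq -scalerBr relspanZ // -pres_pi_eq.
by rewrite pres_reprK.
Qed.

Fact pres_scaleA a b x : pres_scale a (pres_scale b x) = pres_scale (a * b) x.
Proof. by rewrite -[x]pres_reprK !pres_scale_pi scalerA. Qed.

Fact pres_scale1 : left_id 1 pres_scale.
Proof. by move=> x; rewrite -[x]pres_reprK pres_scale_pi scale1r. Qed.

Fact pres_scaleDr : right_distributive pres_scale +%R.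
Proof.
move=> a x y; rewrite -[x]pres_reprK -[y]pres_reprK -pres_piD !pres_scale_pi.
by rewrite scalerDr pres_piD.
Qed.

Fact pres_scaleDl x : {morph pres_scale^~ x : a b / a + b}.
Proof.
by move=> a b; rewrite -[x]pres_reprK !pres_scale_pi scalerDl pres_piD.
Qed.

HB.instance Definition _ := GRing.Zmodule_isLmodule.Build k pres
  pres_scaleA pres_scale1 pres_scaleDr pres_scaleDl.

Definition gen (w : W) : pres := pres_pi << w >>.

(* The linear map [w] |-> g w.  It is computed on a representative; whenever g
   respects the relations this is immaterial and [ext g] is the unique linear
   map with this property: see [ext_linear], [ext_gen] and [ext_unique]. *)
Definition ext (M : lmodType k) (g : W -> M) (x : pres) : M :=
  fglift g (pres_repr x).

Section Universal.
Variables (M : lmodType k) (g : W -> M).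

Fact fglift_linear : linear (fglift g : {freeg W / k} -> M).
Proof.
have fgD : {morph (fglift g : {freeg W / k} -> M) : x y / x + y}.
  move=> x y; have fgB := lift_is_additive g.
  have fg0 : fglift g (0 : {freeg W / k}) = 0.
    by rewrite -(subrr (0 : {freeg W / k})) fgB subrr.
  have fgN z : fglift g (- z : {freeg W / k}) = - fglift g z.
    by rewrite -[- z]sub0r fgB fg0 sub0r.
  by rewrite -{1}[y]opprK fgB fgN opprK.
have fgS (s : seq W) (F : W -> {freeg W / k}) :
    fglift g (\sum_(x <- s) F x) = \sum_(x <- s) fglift g (F x).
  elim: s => [|x s IHs]; last by rewrite !big_cons fgD IHs.
  by rewrite !big_nil -(subrr (0 : {freeg W / k})) lift_is_additive subrr.
move=> c x y; rewrite fgD; congr (_ + _).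
rewrite [c *: x]/(fgscale c x) /fgscale fgS -[in RHS](freeg_sumE x) fgS.
by rewrite scaler_sumr; apply: eq_bigr => w _; rewrite !liftU scalerA.
Qed.

Hypothesis gRel : forall r, Rel r -> fglift g r = 0.

Lemma ext_pi x : ext g (pres_pi x) = fglift g x.
Proof.
have [gB gZ] : additive (fglift g : {freeg W / k} -> M) /\
               scalable (fglift g : {freeg W / k} -> M).
  split; [exact: lift_is_additive | exact: (scalable_linear fglift_linear)].
apply/eqP; rewrite -subr_eq0 -gB.
have: pres_repr (pres_pi x) - x \in relspan.
  by rewrite -pres_pi_eq pres_reprK.
move=> /asboolP[s [sR ->]].
have g0 : fglift g (0 : {freeg W / k}) = 0.
  by rewrite -(subrr (0 : {freeg W / k})) gB subrr.
elim: s sR => [|p s IHs] sR; first by rewrite big_nil g0.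
rewrite big_cons fglift_linear (gRel (sR p _)) ?mem_head // scaler0 add0r.
by apply: IHs => q qs; apply: sR; rewrite in_cons qs orbT.
Qed.

Lemma ext_linear : linear (ext g).
Proof.
move=> c x y; rewrite -[x]pres_reprK -[y]pres_reprK.
rewrite [c *: _]pres_scale_pi -pres_piD !ext_pi.
exact: fglift_linear.
Qed.

Lemma ext_gen w : ext g (gen w) = g w.
Proof. by rewrite ext_pi liftU scale1r. Qed.

End Universal.

Lemma pres_ind (P : pres -> Prop) :
  P 0 -> (forall c w x, P x -> P (c *: gen w + x)) -> forall x, P x.
Proof.
move=> P0 PS x; rewrite -[x]pres_reprK -[pres_repr x]freeg_sumE.
have pi0 : pres_pi 0 = 0 by rewrite -(subrr (0 : {freeg W / k})) pres_piB subrr.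
elim: (dom _) => [|w s IHs]; first by rewrite big_nil pi0.
rewrite big_cons pres_piD.
have -> : << coeff w (pres_repr x) *g w >>
        = coeff w (pres_repr x) *: << w >> :> {freeg W / k}.
  by apply/eqP/freeg_eqP => v; rewrite coeffZ !coeffU mul1r.
by rewrite -pres_scale_pi; apply: PS.
Qed.

Lemma ext_unique (M : lmodType k) (F G : {linear pres -> M}) :
  (forall w, F (gen w) = G (gen w)) -> F =1 G.
Proof.
move=> FG x; elim/pres_ind: x => [|c w x IHx]; first by rewrite !linear0.
by rewrite !linearP FG IHx.
Qed.

End Presented.

(* The obstruction to the linearity of a map u from M to the basis W; setting
   all of them to 0 makes m |-> [u m] linear. *)
Definition lindef (k : comNzRingType) (W : choiceType) (M : lmodType k)
    (u : M -> W) (c : k) (m m' : M) : {freeg W / k} :=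
  << u (c *: m + m') >> - c *: << u m >> - << u m' >>.

Inductive kspan (k : comNzRingType) (M : lmodType k) (G : M -> Prop) :
    M -> Prop :=
  | kspan0 : kspan G 0
  | kspanP c x y : G x -> kspan G y -> kspan G (c *: x + y).

Section Tensor.
Context (k : comNzRingType) (M N : lmodType k).

Inductive tensor_rel : {freeg (M * N)%type / k} -> Prop :=
  | tensor_rell n c m m' : tensor_rel (lindef (fun x => (x, n)) c m m')
  | tensor_relr m c n n' : tensor_rel (lindef (fun y => (m, y)) c n n').

Definition tensor : Type := pres tensor_rel.
HB.instance Definition _ := GRing.Lmodule.on tensor.

Definition tens (m : M) (n : N) : tensor := gen tensor_rel (m, n).

Definition tlift (P : lmodType k) (g : M -> N -> P) (x : tensor) : P :=
  ext (fun mn => g mn.1 mn.2) x.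

Section Lift.
Variables (P : lmodType k) (g : M -> N -> P).
Hypotheses (gl : forall n, linear (g^~ n)) (gr : forall m, linear (g m)).

Fact tlift_rel r : tensor_rel r -> fglift (fun mn => g mn.1 mn.2) r = 0.
Proof.
have gZ := scalable_linear (fglift_linear (fun mn => g mn.1 mn.2)).
have gB := lift_is_additive (fun mn => g mn.1 mn.2).
by case=> [n c m m' | m c n n']; rewrite /lindef !gB gZ !liftU !scale1r /=
  ?gl ?gr addrAC addrK subrr.
Qed.

Lemma tlift_linear : linear (tlift g).
Proof. exact: ext_linear tlift_rel. Qed.

Lemma tliftE m n : tlift g (tens m n) = g m n.
Proof. exact: (ext_gen tlift_rel). Qed.
End Lift.
End Tensor.

Notation "m \ox n" := (tens m n) (at level 40, left associativity) : ring_scope.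

Record hopfAlgebra (k : comNzRingType) := HopfAlgebra {
  hopf_alg :> algType k;
  comul : {linear hopf_alg -> tensor hopf_alg hopf_alg};
  counit : {linear hopf_alg -> k^o};
  antipode : {linear hopf_alg -> hopf_alg};
  comul1 : comul 1 = 1 \ox 1;
  comulM : forall h l, comul (h * l) =
    tlift (fun h1 h2 => tlift (fun l1 l2 => (h1 * l1) \ox (h2 * l2)) (comul l))
          (comul h);
  counit1 : counit 1 = 1;
  counitM : forall h l, counit (h * l) = counit h * counit l;
  comulA : forall h,
    tlift (fun x h3 => tlift (fun h1 h2 => h1 \ox (h2 \ox h3)) (comul x))
          (comul h)
    = tlift (fun h1 x => h1 \ox comul x) (comul h);
  comul_counitl : forall h, tlift (fun h1 h2 => counit h1 *: h2) (comul h) = h;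
  comul_counitr : forall h, tlift (fun h1 h2 => counit h2 *: h1) (comul h) = h;
  antipodel : forall h,
    tlift (fun h1 h2 => antipode h1 * h2) (comul h) = counit h *: 1;
  antipoder : forall h,
    tlift (fun h1 h2 => h1 * antipode h2) (comul h) = counit h *: 1
}.

Section Sweedler.
Context (k : comNzRingType) (H : hopfAlgebra k) (P : lmodType k).

Definition sw2 (h : H) (F : H -> H -> P) : P := tlift F (comul H h).

Definition sw3 (h : H) (F : H -> H -> H -> P) : P :=
  tlift (fun x h3 => tlift (fun h1 h2 => F h1 h2 h3) (comul H x)) (comul H h).

Fixpoint swl (hs : seq H) (F : seq H -> seq H -> P) : P :=
  if hs is h :: hs' then
    sw2 h (fun h1 h2 => swl hs' (fun u v => F (h1 :: u) (h2 :: v)))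
  else F [::] [::].
End Sweedler.

Record weakAction (k : comNzRingType) (H : hopfAlgebra k) (A : algType k) :=
  WeakAction {
  wact : {bilinear H -> A -> A};
  wactM : forall h a b, wact h (a * b) = sw2 h (fun h1 h2 => wact h1 a * wact h2 b);
  wact1r : forall h, wact h 1 = counit H h *: 1;
  wact1l : forall a, wact 1 a = a
}.

Section CrossedProduct.
Context (k : comNzRingType) (H : hopfAlgebra k) (A : algType k).

(* The k-module A \ox H underlying the crossed product; a # h is a \ox h. *)
Definition cprod : Type := tensor A H.
HB.instance Definition _ := GRing.Lmodule.on cprod.

Definition cpair (a : A) (h : H) : cprod := a \ox h.
Definition cone : cprod := cpair 1 1.
Definition cplift (P : lmodType k) (g : A -> H -> P) (x : cprod) : P := tlift g x.

Definition in_base (x : cprod) : Prop := exists a : A, x = cpair a 1.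

Context (w : weakAction H A) (f : {linear tensor H H -> A}).

(* (a # h)(b # l) = a b^(h_1) f(h_2, l_1) # h_3 l_2 *)
Definition cmul (x y : cprod) : cprod :=
  cplift (fun a h => cplift (fun b l =>
    sw3 h (fun h1 h2 h3 => sw2 l (fun l1 l2 =>
      cpair (a * wact w h1 b * f (h2 \ox l1)) (h3 * l2)))) y) x.

Definition is_crossed_product : Prop :=
  [/\ associative cmul, left_id cone cmul & right_id cone cmul].

(* a^(h_i ... h_j) = (..((a^h_j)^h_(j-1))..)^h_i *)
Definition wactl (hs : seq H) (a : A) : A := foldr (fun h b => wact w h b) a hs.
End CrossedProduct.

Notation "a # h" := (cpair a h) (at level 40, left associativity) : ring_scope.

(* Multiply the entries of indices i and i+1 of s. *)
Definition merge_at (T : Type) (mul : T -> T -> T) (x0 : T) (i : nat) (s : seq T) :=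
  take i s ++ mul (nth x0 s i) (nth x0 s i.+1) :: drop i.+2 s.

(* Course-of-values recursion: srec n = step n srec, where the second argument
   of step is only meaningful below n: see [srecE]. *)
Section Srec.
Variables (T : Type) (t0 : T) (step : nat -> (nat -> T) -> T).

Fixpoint srec_table (n : nat) : seq T :=
  if n is m.+1 then rcons (srec_table m) (step m (nth t0 (srec_table m)))
  else [::].

Definition srec (n : nat) : T := step n (nth t0 (srec_table n)).

Fact size_srec_table n : size (srec_table n) = n.
Proof. by elim: n => //= n IHn; rewrite size_rcons IHn. Qed.

Fact nth_srec_table n m : (m < n)%N -> nth t0 (srec_table n) m = srec m.
Proof.
elim: n => // n IHn; rewrite ltnS leq_eqVlt nth_rcons size_srec_table.
by case/predU1P=> [->|lt_mn]; [rewrite ltnn eqxx | rewrite lt_mn IHn].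
Qed.

Lemma srecE n : (forall u v, (forall m, (m < n)%N -> u m = v m) ->
  step n u = step n v) -> srec n = step n srec.
Proof. by apply=> m; apply: nth_srec_table. Qed.
End Srec.

(* X = \bigoplus_(r, s) X_rs, Y = \bigoplus_s Y_s and B = \bigoplus_n B_n(E) are
   each presented as one module, generated by words of arbitrary length.
   The relations preserve lengths; those of a given length say that a word is
   multilinear in its entries and vanishes as soon as one of its inner entries
   is 1, which present the tensor products of E, H/k, A/k, E/k.
   Maps that are defined on some summands only are extended by 0. *)
Section Resolutions.
Context (k : comNzRingType) (H : hopfAlgebra k) (A : algType k).
Local Notation E := (cprod H A).

Definition wordX : Type := (E * seq H * seq A * E)%type.
HB.instance Definition _ := Choice.on wordX.

Inductive relX : {freeg wordX / k} -> Prop :=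
  | relX_l hs aa e' c x y : relX (lindef (fun e => (e, hs, aa, e') : wordX) c x y)
  | relX_r e hs aa c x y : relX (lindef (fun e' => (e, hs, aa, e') : wordX) c x y)
  | relX_h e u v aa e' c x y :
      relX (lindef (fun h => (e, u ++ h :: v, aa, e') : wordX) c x y)
  | relX_h1 e u v aa e' : relX << (e, u ++ 1 :: v, aa, e') : wordX >>
  | relX_a e hs u v e' c x y :
      relX (lindef (fun a => (e, hs, u ++ a :: v, e') : wordX) c x y)
  | relX_a1 e hs u v e' : relX << (e, hs, u ++ 1 :: v, e') : wordX >>.

Definition X : Type := pres relX.
HB.instance Definition _ := GRing.Lmodule.on X.

Definition genX (e : E) (hs : seq H) (aa : seq A) (e' : E) : X :=
  gen relX (e, hs, aa, e').
Definition extX (P : lmodType k) (g : E -> seq H -> seq A -> E -> P) (x : X) : P :=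
  ext (fun w : wordX => let: (e, hs, aa, e') := w in g e hs aa e') x.

Definition wordY : Type := (E * seq H * H)%type.
HB.instance Definition _ := Choice.on wordY.

Inductive relY : {freeg wordY / k} -> Prop :=
  | relY_l hs h' c x y : relY (lindef (fun e => (e, hs, h') : wordY) c x y)
  | relY_r e hs c x y : relY (lindef (fun h' => (e, hs, h') : wordY) c x y)
  | relY_h e u v h' c x y :
      relY (lindef (fun h => (e, u ++ h :: v, h') : wordY) c x y)
  | relY_h1 e u v h' : relY << (e, u ++ 1 :: v, h') : wordY >>.

Definition Y : Type := pres relY.
HB.instance Definition _ := GRing.Lmodule.on Y.

Definition genY (e : E) (hs : seq H) (h' : H) : Y := gen relY (e, hs, h').
Definition extY (P : lmodType k) (g : E -> seq H -> H -> P) (y : Y) : P :=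
  ext (fun w : wordY => let: (e, hs, h') := w in g e hs h') y.

Definition wordB : Type := (E * seq E * E)%type.
HB.instance Definition _ := Choice.on wordB.

Inductive relB : {freeg wordB / k} -> Prop :=
  | relB_l es e' c x y : relB (lindef (fun e => (e, es, e') : wordB) c x y)
  | relB_r e es c x y : relB (lindef (fun e' => (e, es, e') : wordB) c x y)
  | relB_i e u v e' c x y :
      relB (lindef (fun z => (e, u ++ z :: v, e') : wordB) c x y)
  | relB_1 e u v e' : relB << (e, u ++ cone H A :: v, e') : wordB >>.

Definition B : Type := pres relB.
HB.instance Definition _ := GRing.Lmodule.on B.

Definition genB (e : E) (es : seq E) (e' : E) : B := gen relB (e, es, e').
Definition extB (P : lmodType k) (g : E -> seq E -> E -> P) (x : B) : P :=
  ext (fun w : wordB => let: (e, es, e') := w in g e es e') x.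

(* a_0 # h_0, h_1, ..., h_s, a_1, ..., a_r, a_(r+1) # h_(s+1), with aa the list
   of a_1, ..., a_(r+1). *)
Definition mkX (a0 : A) (h0 : H) (hs : seq H) (aa : seq A) (h' : H) : X :=
  if aa is a1 :: t then genX (a0 # h0) hs (belast a1 t) (last a1 t # h') else 0.

(* a (x) h_0 (x) ... (x) h_(s+1), with hh the list of h_0, ..., h_(s+1). *)
Definition mkY (a : A) (hh : seq H) : Y :=
  if hh is h0 :: h1 :: t then genY (a # h0) (belast h1 t) (last h1 t) else 0.

Definition mkB (es : seq E) : B :=
  if es is x0 :: x1 :: t then genB x0 (belast x1 t) (last x1 t) else 0.

Context (w : weakAction H A) (f : {linear tensor H H -> A}).
Local Notation "x *E y" := (cmul w f x y) (at level 40, left associativity).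
Local Notation "1E" := (cone H A).

Definition lmulX (c : E) : X -> X :=
  extX (fun e hs aa e' => genX (c *E e) hs aa e').
Definition rmulX (x : X) (c : E) : X :=
  extX (fun e hs aa e' => genX e hs aa (e' *E c)) x.
Definition lmulB (c : E) : B -> B := extB (fun e es e' => genB (c *E e) es e').
Definition rmulB (x : B) (c : E) : B :=
  extB (fun e es e' => genB e es (e' *E c)) x.

Definition mu : X -> Y := extX (fun e hs aa e' =>
  if aa is [::] then
    cplift (fun a0 h0 => cplift (fun a1 h' =>
      sw2 h0 (fun x y => swl hs (fun u v =>
        genY ((a0 * wactl w (x :: u) a1) # y) v h'))) e') e
  else 0).

Definition d0 : X -> X := extX (fun e hs aa e' =>
  if aa is a1 :: t then
    cplift (fun a0 h0 => cplift (fun a' h' =>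
      sw2 h0 (fun x y => swl hs (fun u v =>
        mkX (a0 * wactl w (x :: u) a1) y v (rcons t a') h'))
      + \sum_(i < size aa)
          (-1) ^+ i.+1 *: mkX a0 h0 hs (merge_at *%R 0 i (rcons aa a')) h') e') e
  else 0).

(* The map \partial_s for s > 0; Y_(-1) is not part of Y, and \partial_0 is not
   needed. *)
Definition partial : Y -> Y := extY (fun e hs h' =>
  cplift (fun a h0 =>
    let hh := h0 :: rcons hs h' in
    \sum_(i < (size hs).+1) (-1) ^+ i.+1 *:
      swl (take i hh) (fun u v =>
      sw2 (nth 0 hh i) (fun x y => sw2 (nth 0 hh i.+1) (fun x' y' =>
        mkY (a * wactl w u (f (x \ox x'))) (v ++ (y * y') :: drop i.+2 hh))))) e).

Definition sigma0Y : Y -> X := extY (fun e hs h' => genX e hs [::] (1 # h')).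

Definition sigma0X : X -> X := extX (fun e hs aa e' =>
  (-1) ^+ (size aa).+1 *: cplift (fun a h => genX e hs (rcons aa a) (1 # h)) e').

(* [dgen l dprev r] is d^l on X_r*, for l > 0, given the d^j for j < l. *)
Fixpoint dgen (l : nat) (dprev : nat -> X -> X) (r : nat) : X -> X :=
  extX (fun e hs aa e' =>
    if (size aa == r) && (l <= size hs)%N then
      let x := genX 1E hs aa 1E in
      let y := match r with
        | 0 =>
          if l == 1%N then - sigma0Y (partial (mu x))
          else - \sum_(1 <= j < l) sigma0X (dprev (l - j)%N (dprev j x))
        | r'.+1 =>
          - (sigma0X (dgen l dprev r' (d0 x))
             + \sum_(1 <= j < l) sigma0X (dprev (l - j)%N (dprev j x)))
        end in
      lmulX e (rmulX y e')
    else 0).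

Definition dl : nat -> X -> X := srec (fun=> 0) (fun l dprev =>
  if l == 0%N then d0
  else extX (fun e hs aa e' => dgen l dprev (size aa) (genX e hs aa e'))).

Definition d : X -> X := extX (fun e hs aa e' =>
  \sum_(l < (size hs).+1 | (0 < size aa + l)%N) dl l (genX e hs aa e')).

Definition sigma_next (V : Type) (sigma0 : V -> X) : nat -> V -> X :=
  srec (fun=> 0) (fun l sprev =>
    if l == 0%N then sigma0
    else fun v => - \sum_(i < l) sigma0X (dl (l - i)%N (sprev i v))).

Definition sigmaY : nat -> Y -> X := sigma_next sigma0Y.
Definition sigmaX : nat -> X -> X := sigma_next sigma0X.

(* \sigma^(-1)_(s+1) : Y_s -> Y_(s+1) for s >= 0. *)
Definition sigmam1 : Y -> Y := extY (fun e hs h' =>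
  (-1) ^+ size hs *: genY e (rcons hs h') 1).

(* \bar\sigma_(n+1) : X_n -> X_(n+1) for n >= 0. *)
Definition sigmabar : X -> X := extX (fun e hs aa e' =>
  let x := genX e hs aa e' in let n := (size hs + size aa)%N in
  - \sum_(l < n.+2) sigmaY l (sigmam1 (mu x)) + \sum_(l < (size hs).+1) sigmaX l x).

Definition bprime : B -> B := extB (fun e es e' =>
  let xs := e :: rcons es e' in
  \sum_(i < (size es).+1) (-1) ^+ i *: mkB (merge_at (cmul w f) 0 i xs)).

Definition xi : B -> B := extB (fun e es e' =>
  (-1) ^+ (size es).+1 *: genB e (rcons es e') 1E).

Fixpoint phi (n : nat) : X -> B :=
  if n is m.+1 then extX (fun e hs aa e' =>
    if (size hs + size aa == n)%N then
      rmulB (xi (phi m (d (genX e hs aa 1E)))) e'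
    else 0)
  else extX (fun e hs aa e' =>
    if (size hs + size aa == 0)%N then genB e [::] e' else 0).

Fixpoint psi (n : nat) : B -> X :=
  if n is m.+1 then extB (fun e es e' =>
    if size es == n then
      rmulX (sigmabar (psi m (bprime (genB e es 1E)))) e'
    else 0)
  else extB (fun e es e' => if size es == 0%N then genX e [::] [::] e' else 0).

(* omega (n + 1) : B_n -> B_(n+1); omega 0 is a dummy. *)
Fixpoint omega (n : nat) : B -> B :=
  if n is m.+1 then
    if m is 0 then fun=> 0 else extB (fun e es e' =>
      if size es == m then
        let z := genB e es 1E in
        rmulB (xi (phi m (psi m z) - z - omega m (bprime z))) e'
      else 0)
  else fun=> 0.

Definition filX (i n : nat) : X -> Prop :=
  kspan (fun x => exists e hs aa e',
    [/\ (size hs <= i)%N, (size hs + size aa = n)%N & x = genX e hs aa e']).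

Inductive subbimod (G : B -> Prop) : B -> Prop :=
  | subbimod_gen x : G x -> subbimod G x
  | subbimod0 : subbimod G 0
  | subbimodD x y : subbimod G x -> subbimod G y -> subbimod G (x + y)
  | subbimodl c x : subbimod G x -> subbimod G (lmulB c x)
  | subbimodr c x : subbimod G x -> subbimod G (rmulB x c).

Definition filB (i n : nat) : B -> Prop :=
  subbimod (fun x => exists es,
    [/\ size es = n, (n - i <= count (fun e => `[< in_base e >]) es)%N
      & x = genB 1E es 1E]).
End Resolutions.

(* Main.v *)
Require Import Defs.
From mathcomp Require Import all_boot all_algebra.
From mathcomp Require Import boolp zify.
From mathcomp.multinomials Require Import freeg.

(* Everything follows by counting degrees, once the maps are known to respect
   the relations presenting X, Y and B; none of the identities d d = 0,
   b' b' = 0 or the homotopy relations is needed.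
   Refine both filtrations: let G^i(X_n) be F^(i-1)(X_n) plus the words of
   degree exactly i whose last factor lies in A, and let G^i(B_n) be spanned by
   the x_0 (x) ... (x) x_(n+1) such that at least n + 1 - i of
   x_1, ..., x_(n+1) lie in A.  For a word with last factor 1 in degree n + 1 of
   F^i, d and b' land in G^i, because d^l lowers the filtration by l and d^0
   keeps the last factor in A; xi sends G^i(B_n) back to words of F^i(B_(n+1))
   with last factor 1.  The homotopy preserves G^i: the only term that raises
   the filtration is sigma^0 sigma^(-1) mu, which kills the words with last
   factor in A (they acquire an inner factor 1) and otherwise produces last
   factor 1.  Induction on n concludes. *)

Set Implicit Arguments.
Unset Strict Implicit.
Unset Printing Implicit Defensive.

Import GRing.Theory.
Local Open Scope ring_scope.

(** The bulk of the work hides in the clause about relations. The maps on X, Y and B are given by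
    [ext], which evaluates on a chosen representative, so neither additivity nor the value on a word
    is available before multilinearity and vanishing on an inner 1 have been checked. For [d0],
    [partial] and [bprime] this vanishing is a cancellation: the two terms merging the 1 with its
    left and with its right neighbour have opposite signs (in [d0], for a leading 1, the action term
    replaces the left merge). For [partial] this rests on f(h, 1) = f(1, h) = epsilon(h), recovered
    from the unit laws of E by applying the counit to the H-component. The refinement is forced by
    [xi], which turns the last factor into an inner one: a word of F^i stays in F^i only if that
    factor lies in A or a unit of filtration was to spare. The map sigma^(-1) sets the matching
    constraint on X. A subtlety is that an element of E lying in A may be represented by a sum of
    pairs a # h with h different from 1. Conditions on last factors are therefore put on words with
    an entry in E, and lifts at an element of A are evaluated at a # 1 rather than expanded along a
    representative. *)

Definition lin (k : comNzRingType) (U V : lmodType k) (F : U -> V) : Prop :=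
  linear F.

(** * Linearity as a predicate, and spans *)

Section Linear.
Context (k : comNzRingType).
Implicit Types U V W : lmodType k.

Lemma lin0 U V (F : U -> V) : lin F -> F 0 = 0.
Proof.
by move=> Fl; have := Fl (-1) 0 0; rewrite scaler0 addr0 scaleN1r addNr.
Qed.

Lemma lin_ext U V (F G : U -> V) : F =1 G -> lin G -> lin F.
Proof. by move=> FG Gl c x y; rewrite !FG Gl. Qed.

Lemma lin_cst0 U V : lin (fun _ : U => 0 : V).
Proof. by move=> c x y; rewrite scaler0 addr0. Qed.

Lemma lin_id U : lin (@id U).
Proof. by []. Qed.

Lemma lin_comp U V W (F : V -> W) (G : U -> V) :
  lin F -> lin G -> lin (fun x => F (G x)).
Proof. by move=> Fl Gl c x y; rewrite Gl Fl. Qed.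

Lemma lin_add U V (F G : U -> V) : lin F -> lin G -> lin (fun x => F x + G x).
Proof. by move=> Fl Gl c x y; rewrite Fl Gl scalerDr addrACA. Qed.

Lemma lin_scale U V (a : k) (F : U -> V) : lin F -> lin (fun x => a *: F x).
Proof. by move=> Fl c x y; rewrite Fl scalerDr !scalerA mulrC. Qed.

Lemma lin_opp U V (F : U -> V) : lin F -> lin (fun x => - F x).
Proof. by move=> Fl c x y; rewrite Fl opprD scalerN. Qed.

Lemma lin_if U V (b : bool) (F : U -> V) :
  lin F -> lin (fun x => if b then F x else 0).
Proof. by case: b => // _; apply: lin_cst0. Qed.

Lemma lin_sum U V (I : Type) (r : seq I) (P : pred I) (F : I -> U -> V) :
  (forall i, P i -> lin (F i)) -> lin (fun x => \sum_(i <- r | P i) F i x).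
Proof.
move=> Fl c x y; rewrite scaler_sumr -big_split.
by apply: eq_bigr => i Pi; rewrite Fl.
Qed.

Lemma lin_mull U (A : algType k) (a : A) (F : U -> A) :
  lin F -> lin (fun x => a * F x).
Proof. by move=> Fl c x y; rewrite Fl mulrDr scalerAr. Qed.

Lemma lin_mulr U (A : algType k) (a : A) (F : U -> A) :
  lin F -> lin (fun x => F x * a).
Proof. by move=> Fl c x y; rewrite Fl mulrDl scalerAl. Qed.

Lemma lin_morph U V (F : {linear U -> V}) : lin F.
Proof. by move=> c x y; rewrite linearP. Qed.

Lemma kspan_mem U (G : U -> Prop) x : G x -> kspan G x.
Proof. by move=> Gx; rewrite -[x]scale1r -[_ *: x]addr0; do 2?constructor. Qed.

Lemma kspanD U (G : U -> Prop) x y : kspan G x -> kspan G y -> kspan G (x + y).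
Proof.
by move=> + Gy; elim=> [|c u v Gu _ IH]; rewrite ?add0r -?addrA //; constructor.
Qed.

Lemma kspanZ U (G : U -> Prop) c x : kspan G x -> kspan G (c *: x).
Proof.
elim=> [|b u v Gu _ IH]; first by rewrite scaler0; constructor.
by rewrite scalerDr scalerA; constructor.
Qed.

Lemma kspanN U (G : U -> Prop) x : kspan G x -> kspan G (- x).
Proof. by rewrite -scaleN1r; apply: kspanZ. Qed.

Lemma kspan_sum U (G : U -> Prop) (I : eqType) (r : seq I) (P : pred I)
    (F : I -> U) :
  (forall i, i \in r -> P i -> kspan G (F i)) ->
  kspan G (\sum_(i <- r | P i) F i).
Proof.
move=> FG; rewrite big_seq_cond; apply: big_ind => [|x y|i /andP[]].
- exact: kspan0.
- exact: kspanD.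
- exact: FG.
Qed.

Lemma kspan_lin U V (F : U -> V) (G : U -> Prop) (G' : V -> Prop) x :
  lin F -> (forall y, G y -> kspan G' (F y)) -> kspan G x -> kspan G' (F x).
Proof.
move=> Fl FG; elim=> [|c u v Gu _ IH]; first by rewrite (lin0 Fl); constructor.
by rewrite Fl; apply: kspanD IH; apply/kspanZ/FG.
Qed.

Lemma kspan_mono U (G G' : U -> Prop) x :
  (forall y, G y -> G' y) -> kspan G x -> kspan G' x.
Proof. by move=> GG'; apply: kspan_lin => // y /GG'; apply: kspan_mem. Qed.

End Linear.

(** * Extensions from generators, computed on representatives *)

Section ExtTheory.
Context (k : comNzRingType) (W : choiceType) (Rel : {freeg W / k} -> Prop).
Local Notation pres := (pres Rel).

(** This holds for every g, whether or not it respects the relations. Linearity in a parameter and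
    membership in a span can thus be read off generator by generator without any well-definedness
    argument. *)
Lemma extE (M : lmodType k) (g : W -> M) (x : pres) :
  ext g x = \sum_(w <- dom (pres_repr x)) coeff w (pres_repr x) *: g w.
Proof.
rewrite /ext -{1}[pres_repr x]freeg_sumE.
have fgl := fglift_linear g; have fg0 := lin0 fgl.
elim: (dom _) => [|v s IHs]; first by rewrite !big_nil.
by rewrite !big_cons -[<<_ *g _>>]scale1r fgl scale1r liftU IHs.
Qed.

Lemma lin_ext_param (U M : lmodType k) (K : U -> W -> M) (x : pres) :
  (forall w, lin (K^~ w)) -> lin (fun z => ext (K z) x).
Proof.
move=> Kl; apply: lin_ext => [z|]; first exact: extE.
by apply: lin_sum => w _; apply/lin_scale/Kl.
Qed.

Lemma ext_kspan (M : lmodType k) (g : W -> M) (G : M -> Prop) (x : pres) :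
  (forall w, kspan G (g w)) -> kspan G (ext g x).
Proof. by move=> gG; rewrite extE; apply: kspan_sum => w _ _; apply/kspanZ/gG. Qed.

Lemma ext0 (M : lmodType k) (g : W -> M) (x : pres) :
  (forall w, g w = 0) -> ext g x = 0.
Proof. by move=> g0; rewrite extE big1 // => w _; rewrite g0 scaler0. Qed.

Lemma fglift_lindef (M N : lmodType k) (u : N -> W) (g : W -> M) c m m' :
  lin (fun z => g (u z)) -> fglift g (lindef u c m m') = 0.
Proof.
have gZ := scalable_linear (fglift_linear g).
have gB := lift_is_additive g.
by move=> gl; rewrite /lindef !gB gZ !liftU !scale1r gl addrAC addrK subrr.
Qed.

Lemma gen_lindef (N : lmodType k) (u : N -> W) :
  (forall c m m', Rel (lindef u c m m')) -> lin (fun z => gen Rel (u z)).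
Proof.
move=> uR c x y; apply/eqP; rewrite -subr_eq0 opprD addrA.
rewrite /gen [c *: pres_pi _ _]pres_scale_pi -!pres_piB.
have <- : pres_pi Rel 0 = 0 by rewrite -(subrr (0 : {freeg W / k})) pres_piB subrr.
rewrite pres_pi_eq subr0; apply/asboolP; exists [:: (1, lindef u c x y)].
by split=> [p|]; [rewrite mem_seq1 => /eqP->; apply: uR | rewrite big_seq1 scale1r].
Qed.

Lemma gen_rel w : Rel << w >> -> gen Rel w = 0.
Proof.
move=> wR; have <- : pres_pi Rel 0 = 0.
  by rewrite -(subrr (0 : {freeg W / k})) pres_piB subrr.
apply/eqP; rewrite pres_pi_eq subr0; apply/asboolP; exists [:: (1, << w >>)].
by split=> [p|]; [rewrite mem_seq1 => /eqP-> | rewrite big_seq1 scale1r].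
Qed.

End ExtTheory.

(** The varying entry is located by a splitting of the list, as in the relations [relX_h], [relX_a],
    [relY_h] and [relB_i], so that these apply directly. *)
Definition mlin (k : comNzRingType) (M P : lmodType k) (G : seq M -> P) : Prop :=
  forall u v, lin (fun h => G (u ++ h :: v)).

Definition bilin (k : comNzRingType) (M N P : lmodType k) (g : M -> N -> P) :=
  (forall n, lin (g^~ n)) /\ (forall m, lin (g m)).

(** * Bilinear maps and tensor products *)

Section TensorTheory.
Context (k : comNzRingType).
Implicit Types M N P U : lmodType k.

Lemma tens_linl M N (n : N) : lin (fun m : M => m \ox n).
Proof. by apply: gen_lindef => c m m'; apply: tensor_rell. Qed.

Lemma tens_linr M N (m : M) : lin (fun n : N => m \ox n).
Proof. by apply: gen_lindef => c n n'; apply: tensor_relr. Qed.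

Lemma lin_tlift M N P (g : M -> N -> P) : bilin g -> lin (tlift g).
Proof. by case=> gl gr; apply: tlift_linear. Qed.

Lemma bilin_tliftE M N P (g : M -> N -> P) m n :
  bilin g -> tlift g (m \ox n) = g m n.
Proof. by case=> gl gr; apply: tliftE. Qed.

Lemma lin_tlift_param M N P U (K : U -> M -> N -> P) x :
  (forall m n, lin (fun z => K z m n)) -> lin (fun z => tlift (K z) x).
Proof. by move=> Kl; apply: lin_ext_param => -[m n]; apply: Kl. Qed.

Lemma tlift_kspan M N P (g : M -> N -> P) (G : P -> Prop) x :
  (forall m n, kspan G (g m n)) -> kspan G (tlift g x).
Proof. by move=> gG; apply: ext_kspan => -[]. Qed.

Lemma tlift0 M N P (g : M -> N -> P) x : (forall m n, g m n = 0) -> tlift g x = 0.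
Proof. by move=> g0; apply: ext0 => -[]. Qed.

Lemma eq_tlift M N P (g g' : M -> N -> P) x : g =2 g' -> tlift g x = tlift g' x.
Proof. by move=> gg'; congr tlift; apply/funext => m; apply/funext => n. Qed.

Lemma tlift_comp M N P U (F : P -> U) (g : M -> N -> P) x :
  lin F -> F (tlift g x) = tlift (fun m n => F (g m n)) x.
Proof.
move=> Fl; rewrite /tlift !extE.
elim: (dom _) => [|v s IHs]; first by rewrite !big_nil (lin0 Fl).
by rewrite !big_cons Fl IHs.
Qed.

End TensorTheory.

(** * Alternating sums of terms merging two neighbours of a word *)

Section AdjacentTerms.
Context (k : comNzRingType) (M P : lmodType k).
Variable D : seq M -> M -> M -> seq M -> P.

(** Here [D u x y v] stands for the term obtained from the word u, x, y, v by merging x with y. The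
    differentials [d0], [partial] and [bprime] all consist of such terms, so linearity and the
    cancellation at a unit are proved once. *)
Definition adj (i : nat) (s : seq M) : P :=
  D (take i s) (nth 0 s i) (nth 0 s i.+1) (drop i.+2 s).

Lemma adjE u x y v : adj (size u) (u ++ x :: y :: v) = D u x y v.
Proof.
rewrite /adj take_size_cat // nth_cat ltnn subnn.
rewrite nth_cat ltnNge leqnSn subSnn drop_cat.
by rewrite ltnNge (leq_trans (leqnSn _) (leqnSn _)) -addn2 addKn /= drop0.
Qed.

Lemma adjP i s : (i.+1 < size s)%N ->
  exists u x y v, [/\ s = u ++ x :: y :: v, size u = i & adj i s = D u x y v].
Proof.
move=> lt_i; exists (take i s), (nth 0 s i), (nth 0 s i.+1), (drop i.+2 s).
have lt_i' := ltnW lt_i.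
by split; rewrite ?size_take ?lt_i' // -!drop_nth // cat_take_drop.
Qed.

Hypotheses (Du : forall x y v, mlin (fun u => D u x y v))
  (Dx : forall u y v, lin (fun x => D u x y v))
  (Dy : forall u x v, lin (fun y => D u x y v))
  (Dv : forall u x y, mlin (D u x y)).

(** The four hypotheses correspond to the position of z relative to the merged pair: behind it, its
    second member, its first member, or in front of it. The bound on i says that the pair lies
    inside the word. *)
Lemma lin_adj i u v : (i < size u + size v)%N ->
  lin (fun z => adj i (u ++ z :: v)).
Proof.
move=> lt_i.
have [lt_iu|] := ltnP i.+1 (size u).
  have [u' [x [y [u'' [-> <- _]]]]] := adjP lt_iu.
  apply: lin_ext (Dv u' x y u'' v) => z.
  by rewrite -catA /= adjE.
rewrite leq_eqVlt => /predU1P[|].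
  case/lastP: u lt_i => // u h _; rewrite size_rcons => -[<-].
  by apply: lin_ext (Dy u h v) => z; rewrite cat_rcons adjE.
rewrite ltnS leq_eqVlt => /predU1P[eq_i|].
  case: v lt_i => [|h v _]; first by rewrite -eq_i addn0 ltnn.
  by apply: lin_ext (Dx u h v) => z; rewrite -eq_i adjE.
move=> lt_ui; have lt_j : ((i - (size u).+1).+1 < size v)%N.
  by rewrite -subSn // ltn_subLR ?addSn // ltnS ltnW.
have [u' [x [y [v' [-> szu _]]]]] := adjP lt_j.
apply: lin_ext (Du x y v' u u') => z.
rewrite (_ : i = size (u ++ z :: u')); last first.
  by rewrite size_cat /= szu addnS -addSn subnKC.
by rewrite -[RHS]adjE -catA.
Qed.

Variable one : M.
(** The side conditions protect the ends of the word, which may belong to outer factors, where a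
    unit does not annihilate. [Dxy1] compares the two ways of absorbing the unit: into the entry
    before it or into the entry after it. *)
Hypotheses (Du1 : forall u u' x y v, u != [::] -> D (u ++ one :: u') x y v = 0)
  (Dv1 : forall u x y v v', v' != [::] -> D u x y (v ++ one :: v') = 0)
  (Dxy1 : forall u x y v, D u x one (y :: v) = D (rcons u x) one y v).

Lemma adj_first i v : (i.+1 < size v)%N -> forall u, u != [::] ->
  adj (size u + i).+1 (u ++ one :: v) = 0.
Proof.
move=> lt_i u u0; have [u' [x [y [v' [-> szu _]]]]] := adjP lt_i.
have -> : (size u + i).+1 = size (u ++ one :: u').
  by rewrite size_cat /= szu addnS.
have -> : u ++ one :: u' ++ x :: y :: v' = (u ++ one :: u') ++ x :: y :: v'.
  by rewrite -catA.
by rewrite adjE Du1.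
Qed.

Lemma adj_last i u v : (i.+1 < size u)%N -> v != [::] ->
  adj i (u ++ one :: v) = 0.
Proof.
move=> lt_i v0; have [u' [x [y [u'' [-> <- _]]]]] := adjP lt_i.
by rewrite -catA /= adjE Dv1.
Qed.

(* The two terms merging [one] with a neighbour cancel by [Dxy1]; the others
   vanish. *)
Lemma adj_sum u v : u != [::] -> v != [::] ->
  \sum_(i < size u + size v) (-1) ^+ i *: adj i (u ++ one :: v) = 0.
Proof.
move=> u0 v0; rewrite -(big_mkord xpredT (fun i => (-1) ^+ i *: adj i (u ++ one :: v))).
case/lastP: u u0 => // u x _; case: v v0 => // y v _.
rewrite size_rcons /= (big_cat_nat (n := size u)) ?leq0n //=; last first.
  by rewrite addSn (leq_trans (leq_addr _ _) (leqnSn _)).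
rewrite big_nat_cond big1 ?add0r; last first.
  move=> i /andP[/andP[_ lt_i] _]; rewrite adj_last ?scaler0 //.
  by rewrite size_rcons ltnS.
rewrite addSnnS !addnS big_ltn; last by rewrite ltnS (leq_trans (leq_addr _ _) (leqnSn _)).
rewrite big_ltn; last by rewrite !ltnS leq_addr.
rewrite addrA [X in _ + X]big_nat_cond [X in _ + X]big1 ?addr0; last first.
  move=> i /andP[/andP[lt_i lt_iv] _].
  have -> : i = (size (rcons u x) + (i - (size u).+2)).+1.
    by rewrite size_rcons -addSn subnKC.
  rewrite adj_first ?scaler0 ?size_rcons //=; last by case: (u).
  by rewrite ltnS ltn_subLR // !addSn ltnS.
rewrite cat_rcons adjE exprS mulN1r scaleNr -cat_rcons.
have -> : (size u).+1 = size (rcons u x) by rewrite size_rcons.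
by rewrite adjE Dxy1 subrr.
Qed.

End AdjacentTerms.

(** * Sweedler sums, counits and iterated weak actions *)

Section SweedlerTheory.
Context (k : comNzRingType) (H : hopfAlgebra k).
Implicit Types (P U : lmodType k) (h : H) (hs u v : seq H).

Lemma lin_sw2 P (F : H -> H -> P) : bilin F -> lin (fun h => sw2 h F).
Proof. by move=> Fl; apply: lin_comp (lin_tlift Fl) (lin_morph _). Qed.

Lemma lin_sw2_param P U (K : U -> H -> H -> P) h :
  (forall x y, lin (fun z => K z x y)) -> lin (fun z => sw2 h (K z)).
Proof. exact: lin_tlift_param. Qed.

Lemma sw2_1 P (F : H -> H -> P) : bilin F -> sw2 1 F = F 1 1.
Proof. by move=> Fl; rewrite /sw2 comul1 bilin_tliftE. Qed.

Lemma eq_sw2 P (F G : H -> H -> P) h : F =2 G -> sw2 h F = sw2 h G.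
Proof. exact: eq_tlift. Qed.

Lemma sw2_counitl P (G : H -> P) h :
  lin G -> sw2 h (fun x y => counit H x *: G y) = G h.
Proof.
move=> Gl; rewrite -[h in RHS]comul_counitl tlift_comp //.
by apply: eq_tlift => x y; rewrite -[_ *: y]addr0 Gl (lin0 Gl) addr0.
Qed.

Lemma sw2_counitr P (G : H -> P) h :
  lin G -> sw2 h (fun x y => counit H y *: G x) = G h.
Proof.
move=> Gl; rewrite -[h in RHS]comul_counitr tlift_comp //.
by apply: eq_tlift => x y; rewrite -[_ *: x]addr0 Gl (lin0 Gl) addr0.
Qed.

Lemma swl_cat P u v (F : seq H -> seq H -> P) :
  swl (u ++ v) F =
  swl u (fun u1 u2 => swl v (fun v1 v2 => F (u1 ++ v1) (u2 ++ v2))).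
Proof.
by elim: u F => //= h u IHu F; apply: eq_sw2 => x y; rewrite IHu.
Qed.

Lemma eq_swl P hs (F G : seq H -> seq H -> P) :
  (forall u v, size u = size hs -> size v = size hs -> F u v = G u v) ->
  swl hs F = swl hs G.
Proof.
elim: hs F G => /= [|h hs IHhs] F G FG; first exact: FG.
by apply: eq_sw2 => x y; apply: IHhs => u v zu zv; rewrite FG /= ?zu ?zv.
Qed.

Lemma swl0 P hs (F : seq H -> seq H -> P) :
  (forall u v, size u = size hs -> size v = size hs -> F u v = 0) ->
  swl hs F = 0.
Proof.
elim: hs F => /= [|h hs IHhs] F F0; first exact: F0.
by apply: tlift0 => x y; apply: IHhs => u v zu zv; rewrite F0 /= ?zu ?zv.
Qed.

Lemma swl_kspan P hs (F : seq H -> seq H -> P) (G : P -> Prop) :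
  (forall u v, size u = size hs -> size v = size hs -> kspan G (F u v)) ->
  kspan G (swl hs F).
Proof.
elim: hs F => /= [|h hs IHhs] F FG; first exact: FG.
by apply: tlift_kspan => x y; apply: IHhs => u v zu zv; apply: FG; rewrite /= ?zu ?zv.
Qed.

Lemma lin_swl_param P U (K : U -> seq H -> seq H -> P) hs :
  (forall u v, lin (fun z => K z u v)) -> lin (fun z => swl hs (K z)).
Proof.
elim: hs K => /= [|h hs IHhs] K Kl; first exact: Kl.
by apply: lin_sw2_param => x y; apply: IHhs => u v; apply: Kl.
Qed.

Lemma swl_comp P U (L : P -> U) hs (F : seq H -> seq H -> P) :
  lin L -> L (swl hs F) = swl hs (fun u v => L (F u v)).
Proof.
move=> Ll; elim: hs F => //= h hs IHhs F.
by rewrite [LHS]tlift_comp //; apply: eq_tlift => x y; rewrite IHhs.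
Qed.

Lemma mlin_swl P (F : seq H -> seq H -> P) :
  (forall v, mlin (F^~ v)) -> (forall u, mlin (F u)) -> mlin (fun hs => swl hs F).
Proof.
move=> Fl Fr u v; apply: lin_ext => [z|]; first exact: swl_cat.
apply: lin_swl_param => u1 u2 /=; apply: lin_sw2.
by split=> [y|x]; apply: lin_swl_param => v1 v2; [apply: Fl | apply: Fr].
Qed.

(** As the comultiplication sends 1 to 1 (x) 1, a unit entry reappears at the same position in both
    legs, and vanishing on the second leg suffices. The size condition remembers that position, so
    that users can tell whether the unit is a first entry. *)
Lemma swl_unit P u v (F : seq H -> seq H -> P) :
  (forall v, mlin (F^~ v)) -> (forall u, mlin (F u)) ->
  (forall w u' v', size u' = size u -> F w (u' ++ 1 :: v') = 0) ->
  swl (u ++ 1 :: v) F = 0.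
Proof.
move=> Fl Fr F1; rewrite swl_cat; apply: swl0 => u1 u2 _ zu /=.
rewrite sw2_1; first by apply: swl0 => v1 v2 _ _; rewrite F1.
by split=> [y|x]; apply: lin_swl_param => v1 v2; [apply: Fl | apply: Fr].
Qed.

(** Together with [wactl_1] this removes an iterated action on a scalar: the counits which that
    action produces contract the comultiplications of the acting entries. *)
Lemma swl_counit P (G : seq H -> P) hs : mlin G ->
  swl hs (fun u v => (\prod_(h <- u) counit H h) *: G v) = G hs.
Proof.
elim: hs G => /= [|h hs IHhs] G Gl; first by rewrite big_nil scale1r.
rewrite -[RHS](sw2_counitl h (G := fun y => G (y :: hs))); last exact: (Gl [::]).
apply: eq_sw2 => x y; rewrite -(IHhs (fun v => G (y :: v))); last first.
  by move=> u v; apply: (Gl (y :: u)).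
rewrite (swl_comp _ _ (lin_scale (counit H x) (@lin_id k P))).
by apply: eq_swl => u v _ _; rewrite big_cons scalerA.
Qed.

Context (A : algType k) (w : weakAction H A).

Lemma lin_wactr h : lin (wact w h).
Proof. by move=> c a b; rewrite linearPr. Qed.

Lemma lin_wactl_ a : lin (fun h => wact w h a).
Proof. by move=> c x y; rewrite linearPl. Qed.

Lemma lin_wactl hs : lin (wactl w hs).
Proof. by elim: hs => //= h hs; apply: lin_comp (lin_wactr h). Qed.

Lemma mlin_wactl a : mlin (fun hs => wactl w hs a).
Proof.
move=> u v; apply: lin_ext => [h|]; first exact: foldr_cat.
exact: lin_comp (lin_wactl u) (lin_wactl_ _).
Qed.

Lemma wactl_1 hs : wactl w hs 1 = (\prod_(h <- hs) counit H h) *: 1.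
Proof.
elim: hs => /= [|h hs ->]; first by rewrite big_nil scale1r.
rewrite big_cons -[X in wact w h X]addr0 lin_wactr (lin0 (lin_wactr h)) addr0.
by rewrite wact1r scalerA mulrC.
Qed.

End SweedlerTheory.

(** * Lifts from the module underlying the crossed product, and threefold Sweedler sums *)

Section CrossedProductTheory.
Context (k : comNzRingType) (H : hopfAlgebra k) (A : algType k).
Implicit Types (P U : lmodType k).
Local Notation E := (cprod H A).

Lemma lin_tensl (M N U : lmodType k) (F : U -> M) (n : N) :
  lin F -> lin (fun z => F z \ox n).
Proof. exact: lin_comp (tens_linl n). Qed.

Lemma lin_tensr (M N U : lmodType k) (F : U -> N) (m : M) :
  lin F -> lin (fun z => m \ox F z).
Proof. exact: lin_comp (tens_linr m). Qed.

Lemma lin_scalel (U V : lmodType k) (F : U -> k^o) (v : V) :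
  lin F -> lin (fun z => F z *: v).
Proof. by move=> Fl c x y; rewrite Fl scalerDl scalerA. Qed.

Lemma lin_cpairl U (F : U -> A) (h : H) : lin F -> lin (fun z => F z # h : E).
Proof. exact: lin_tensl. Qed.

Lemma lin_cpairr U (F : U -> H) (a : A) : lin F -> lin (fun z => a # F z : E).
Proof. exact: lin_tensr. Qed.

Lemma lin_cplift P U (g : A -> H -> P) (F : U -> E) :
  bilin g -> lin F -> lin (fun z => cplift g (F z)).
Proof. by move=> gl; apply: lin_comp (lin_tlift gl). Qed.

Lemma lin_cplift_param P U (K : U -> A -> H -> P) (x : E) :
  (forall a h, lin (fun z => K z a h)) -> lin (fun z => cplift (K z) x).
Proof. exact: lin_tlift_param. Qed.

Lemma cpliftE P (g : A -> H -> P) a h : bilin g -> cplift g (a # h) = g a h.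
Proof. exact: bilin_tliftE. Qed.

Lemma cplift_kspan P (g : A -> H -> P) (G : P -> Prop) (x : E) :
  (forall a h, kspan G (g a h)) -> kspan G (cplift g x).
Proof. exact: tlift_kspan. Qed.

Lemma cplift0 P (g : A -> H -> P) (x : E) :
  (forall a h, g a h = 0) -> cplift g x = 0.
Proof. exact: tlift0. Qed.

Lemma eq_cplift P (g g' : A -> H -> P) (x : E) :
  g =2 g' -> cplift g x = cplift g' x.
Proof. exact: eq_tlift. Qed.

Lemma lin_sw2_arg P U (F : H -> H -> P) (L : U -> H) :
  bilin F -> lin L -> lin (fun z => sw2 (L z) F).
Proof. by move=> Fl; apply: lin_comp (lin_sw2 Fl). Qed.

Definition trilin P (F : H -> H -> H -> P) : Prop :=
  [/\ forall y z, lin (fun x => F x y z), forall x z, lin (fun y => F x y z)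
    & forall x y, lin (F x y)].

Lemma bilin_sw3 P (F : H -> H -> H -> P) : trilin F ->
  bilin (fun x h3 => sw2 x (fun h1 h2 => F h1 h2 h3)).
Proof.
case=> Fx Fy Fz; split=> [h|x]; last by apply: lin_sw2_param.
by apply: lin_sw2; split.
Qed.

Lemma lin_sw3 P (F : H -> H -> H -> P) : trilin F -> lin (fun h => sw3 h F).
Proof. by move=> Fl; apply: lin_sw2 (bilin_sw3 Fl). Qed.

Lemma lin_sw3_param P U (K : U -> H -> H -> H -> P) h :
  (forall x y z, lin (fun t => K t x y z)) -> lin (fun t => sw3 h (K t)).
Proof.
by move=> Kl; apply: lin_tlift_param => ? ?; apply: lin_tlift_param => ? ?.
Qed.

Lemma sw3_1 P (F : H -> H -> H -> P) : trilin F -> sw3 1 F = F 1 1 1.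
Proof.
move=> Fl; rewrite [LHS](sw2_1 (bilin_sw3 Fl)).
by case: Fl => Fx Fy _; rewrite sw2_1.
Qed.

Lemma sw3_counitl P (G : H -> H -> P) h : bilin G ->
  sw3 h (fun x y z => counit H x *: G y z) = sw2 h G.
Proof. by case=> Gl _; apply: eq_tlift => x z; apply: (sw2_counitl x (Gl z)). Qed.

Lemma eq_sw3 P (F G : H -> H -> H -> P) h :
  (forall x y z, F x y z = G x y z) -> sw3 h F = sw3 h G.
Proof. by move=> FG; apply: eq_tlift => x z; apply: eq_tlift => ? ?. Qed.

End CrossedProductTheory.

(** A second-order pattern abstracts both arguments of a binary operation over the bound variable;
    matching against [fun _ => ?g] then detects which of them is constant. *)
Ltac lin_either F G tacF tacG :=
  lazymatch G with
  | (fun _ => ?g) => tacF g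
  | _ => lazymatch F with (fun _ => ?x) => tacG x end
  end.

(** Descends along the head symbol towards the bound variable. Goals of an unknown shape are left
    open, in particular [swl] over a varying list, which is the business of [mlin_swl]. *)
Ltac lin_tac := cbv beta; lazymatch goal with
  | |- bilin _ => split=> ?; lin_tac
  | |- trilin _ => split=> ? ?; lin_tac
  | |- lin (fun _ => 0) => exact: lin_cst0
  | |- lin (fun z => z) => exact: lin_id
  | |- lin (fun z => @?F z + @?G z) => refine (lin_add _ _); lin_tac
  | |- lin (fun z => - @?F z) => refine (lin_opp _); lin_tac
  | |- lin (fun z => @?G z *: @?F z) => lin_either F G
      ltac:(fun g => refine (lin_scale g _); lin_tac)
      ltac:(fun x => refine (lin_scalel x _); lin_tac)
  | |- lin (fun z => \sum_(_ <- _ | _) _) => apply: lin_sum => ? _; lin_tac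
  | |- lin (fun z => @?G z * @?F z) => lin_either F G
      ltac:(fun g => refine (lin_mull g _); lin_tac)
      ltac:(fun x => refine (lin_mulr x _); lin_tac)
  | |- lin (fun z => tens (@?G z) (@?F z)) => lin_either F G
      ltac:(fun g => refine (lin_tensr g _); lin_tac)
      ltac:(fun x => refine (lin_tensl x _); lin_tac)
  | |- lin (fun z => cpair (@?G z) (@?F z)) => lin_either F G
      ltac:(fun g => refine (lin_cpairr g _); lin_tac)
      ltac:(fun x => refine (lin_cpairl x _); lin_tac)
  | |- lin (fun z => wactl ?w (@?G z) (@?F z)) => lin_either F G
      ltac:(fun g => refine (lin_comp (lin_wactl w g) _); lin_tac)
      ltac:(fun x => lazymatch G with
        | (fun z => ?u ++ @?K z :: ?v) =>
          refine (lin_comp (mlin_wactl w x u v) _); lin_tac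
        | (fun z => ?y :: (?u ++ @?K z :: ?v)) =>
          refine (lin_comp (mlin_wactl w x (y :: u) v) _); lin_tac
        | (fun z => @?K z :: ?v) =>
          refine (lin_comp (mlin_wactl w x [::] v) _); lin_tac
        end)
  | |- lin (fun z => cplift (@?G z) (@?F z)) => lin_either F G
      ltac:(fun g => refine (lin_cplift _ _); lin_tac)
      ltac:(fun x => apply: lin_cplift_param => ? ?; lin_tac)
  | |- lin (fun z => sw2 (@?F z) (@?G z)) => lin_either F G
      ltac:(fun g => refine (lin_sw2_arg _ _); lin_tac)
      ltac:(fun x => apply: lin_sw2_param => ? ?; lin_tac)
  | |- lin (fun z => sw3 (@?F z) (@?G z)) => lin_either F G
      ltac:(fun g => refine (lin_sw3 _); lin_tac)
      ltac:(fun x => apply: lin_sw3_param => ? ? ?; lin_tac)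
  | |- lin (fun z => swl (@?F z) (@?G z)) => lin_either F G
      ltac:(fun g => idtac)
      ltac:(fun x => apply: lin_swl_param => ? ?; lin_tac)
  | |- lin (fun z => ?g (tens (@?G z) (@?F z))) =>
      refine (lin_comp (lin_morph _) _); lin_tac
  | |- lin (fun _ => _) => first [exact: lin_wactl_ | exact: lin_wactr | exact: lin_morph | idtac]
  | |- lin ?F => first [exact: lin_wactr | exact: lin_morph | change (lin (fun z => F z)); lin_tac]
  | |- _ => idtac
  end.

(** * The product of E and the normalization of the cocycle *)

Section Crossed.
Context (k : comNzRingType) (H : hopfAlgebra k) (A : algType k).
Context (w : weakAction H A) (f : {linear tensor H H -> A}).
Local Notation E := (cprod H A).
Local Notation cmul := (cmul w f).
Local Notation "x *E y" := (cmul x y) (at level 40, left associativity).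
Local Notation "1E" := (cone H A).

Lemma bilin_cmul : bilin cmul.
Proof.
split=> [y|x]; rewrite /cmul.
  apply: lin_cplift; last exact: lin_id.
  by split=> z; lin_tac.
by lin_tac.
Qed.

Lemma cmul_pair a h b l : (a # h) *E (b # l) = sw3 h (fun h1 h2 h3 =>
  sw2 l (fun l1 l2 => (a * wact w h1 b * f (h2 \ox l1)) # (h3 * l2))).
Proof. by rewrite /cmul cpliftE ?cpliftE //; lin_tac. Qed.

Lemma in_base1 : in_base 1E. Proof. by exists 1. Qed.

Lemma in_base_mul (x y : E) : in_base x -> in_base y -> in_base (x *E y).
Proof.
move=> [a ->] [b ->]; rewrite cmul_pair sw3_1; last by lin_tac.
by rewrite sw2_1 ?mulr1; [exists (a * wact w 1 b * f (1 \ox 1)) | lin_tac].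
Qed.

Hypothesis crossed : is_crossed_product w f.

Lemma cmul1e : left_id 1E cmul. Proof. by case: crossed. Qed.
Lemma cmule1 : right_id 1E cmul. Proof. by case: crossed. Qed.

Lemma bilin_counit_pair : bilin (fun (a : A) (h : H) => counit H h *: a).
Proof. by lin_tac. Qed.

(** Apply a # h |-> epsilon(h) a to the unit law for 1 # l. The product is the Sweedler sum of f(1,
    l_1) # l_2, and the counit contracts l_2. *)
Lemma cocycle_1l l : f (1 \ox l) = counit H l *: 1.
Proof.
have /(congr1 (cplift (fun a h => counit H h *: a))) := cmul1e (1 # l).
rewrite cmul_pair sw3_1; last by lin_tac.
rewrite cpliftE; last exact: bilin_counit_pair.
rewrite [LHS]tlift_comp; last exact: lin_tlift bilin_counit_pair.
move=> <-; rewrite -(sw2_counitr (G := fun h => f (1 \ox h))); last by lin_tac.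
apply: eq_tlift => x y; rewrite [RHS]cpliftE; last exact: bilin_counit_pair.
by rewrite wact1l !mul1r.
Qed.

(** Same idea with the right unit law, except that two contractions are needed: the action of h_1 on
    1 gives epsilon(h_1), and the map a # h |-> epsilon(h) a removes the last leg. *)
Lemma cocycle_1r h : f (h \ox 1) = counit H h *: 1.
Proof.
have /(congr1 (cplift (fun a h => counit H h *: a))) := cmule1 (1 # h).
rewrite cmul_pair cpliftE; last exact: bilin_counit_pair.
move=> <-; rewrite (eq_sw3 (G := fun x y z => (counit H x : k) *: (f (y \ox 1) # z))).
  rewrite sw3_counitl; last by lin_tac.
  rewrite [RHS]tlift_comp; last exact: lin_tlift bilin_counit_pair.
  rewrite -[LHS](sw2_counitr (G := fun h => f (h \ox 1))); last by lin_tac.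
  apply: eq_tlift => x y; rewrite [RHS]cpliftE //; exact: bilin_counit_pair.
move=> x y z; rewrite sw2_1; last by lin_tac.
rewrite mul1r mulr1 wact1r -scalerAl mul1r.
have := lin_cpairl (A := A) z (@lin_id k A) (counit H x) (f (y \ox 1)) 0.
by rewrite (lin0 (lin_cpairl z (@lin_id k A))) !addr0 => ->.
Qed.

End Crossed.

(** * Universal properties of X, Y and B *)

Section Modules.
Context (k : comNzRingType) (H : hopfAlgebra k) (A : algType k).
Implicit Types (P U : lmodType k).
Local Notation E := (cprod H A).
Local Notation X := (X H A).
Local Notation Y := (Y H A).
Local Notation B := (B H A).
Local Notation "1E" := (cone H A).

(** The relations [relX] read as conditions on g: exactly what makes [extX g] linear with value g on
    words. The records for Y and B play the same role. *)
Record multilinX P (g : E -> seq H -> seq A -> E -> P) : Prop := MultilinX {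
  multilinX_l : forall hs aa e', lin (fun e => g e hs aa e');
  multilinX_r : forall e hs aa, lin (g e hs aa);
  multilinX_h : forall e aa e', mlin (fun hs => g e hs aa e');
  multilinX_a : forall e hs e', mlin (fun aa => g e hs aa e');
  multilinX_h1 : forall e u v aa e', g e (u ++ 1 :: v) aa e' = 0;
  multilinX_a1 : forall e hs u v e', g e hs (u ++ 1 :: v) e' = 0 }.

Record multilinY P (g : E -> seq H -> H -> P) : Prop := MultilinY {
  multilinY_l : forall hs h', lin (fun e => g e hs h');
  multilinY_r : forall e hs, lin (g e hs);
  multilinY_h : forall e h', mlin (fun hs => g e hs h');
  multilinY_h1 : forall e u v h', g e (u ++ 1 :: v) h' = 0 }.

Record multilinB P (g : E -> seq E -> E -> P) : Prop := MultilinB {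
  multilinB_l : forall es e', lin (fun e => g e es e');
  multilinB_r : forall e es, lin (g e es);
  multilinB_i : forall e e', mlin (fun es => g e es e');
  multilinB_1 : forall e u v e', g e (u ++ 1E :: v) e' = 0 }.

Lemma multilin_genX : multilinX (@genX k H A).
Proof.
split.
- by move=> hs aa e'; apply: gen_lindef => c x y; apply: relX_l.
- by move=> e hs aa; apply: gen_lindef => c x y; apply: relX_r.
- by move=> e aa e' u v; apply: gen_lindef => c x y; apply: relX_h.
- by move=> e hs e' u v; apply: gen_lindef => c x y; apply: relX_a.
- by move=> e u v aa e'; apply: gen_rel; apply: relX_h1.
- by move=> e hs u v e'; apply: gen_rel; apply: relX_a1.
Qed.

Lemma multilin_genY : multilinY (@genY k H A).
Proof.
split.
- by move=> hs h'; apply: gen_lindef => c x y; apply: relY_l.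
- by move=> e hs; apply: gen_lindef => c x y; apply: relY_r.
- by move=> e h' u v; apply: gen_lindef => c x y; apply: relY_h.
- by move=> e u v h'; apply: gen_rel; apply: relY_h1.
Qed.

Lemma multilin_genB : multilinB (@genB k H A).
Proof.
split.
- by move=> es e'; apply: gen_lindef => c x y; apply: relB_l.
- by move=> e es; apply: gen_lindef => c x y; apply: relB_r.
- by move=> e e' u v; apply: gen_lindef => c x y; apply: relB_i.
- by move=> e u v e'; apply: gen_rel; apply: relB_1.
Qed.

Section ExtX.
Variables (P : lmodType k) (g : E -> seq H -> seq A -> E -> P).
Hypothesis g_lin : multilinX g.

Let g_rel r : relX r ->
  fglift (fun w : wordX H A => let: (e, hs, aa, e') := w in g e hs aa e') r = 0.
Proof.
case: g_lin => gl gr gh ga gh1 ga1.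
case=> *; rewrite ?liftU ?scale1r ?gh1 ?ga1 //; apply: fglift_lindef.
- exact: gl.
- exact: gr.
- exact: gh.
- exact: ga.
Qed.

Lemma lin_extX : lin (extX g).
Proof. exact: ext_linear g_rel. Qed.

Lemma extXE e hs aa e' : extX g (genX e hs aa e') = g e hs aa e'.
Proof. exact: (ext_gen g_rel). Qed.
End ExtX.

Section ExtY.
Variables (P : lmodType k) (g : E -> seq H -> H -> P).
Hypothesis g_lin : multilinY g.

Let g_rel r : relY r ->
  fglift (fun w : wordY H A => let: (e, hs, h') := w in g e hs h') r = 0.
Proof.
case: g_lin => gl gr gh gh1.
case=> *; rewrite ?liftU ?scale1r ?gh1 //; apply: fglift_lindef.
- exact: gl.
- exact: gr.
- exact: gh.
Qed.

Lemma lin_extY : lin (extY g).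
Proof. exact: ext_linear g_rel. Qed.

Lemma extYE e hs h' : extY g (genY e hs h') = g e hs h'.
Proof. exact: (ext_gen g_rel). Qed.
End ExtY.

Section ExtB.
Variables (P : lmodType k) (g : E -> seq E -> E -> P).
Hypothesis g_lin : multilinB g.

Let g_rel r : relB r ->
  fglift (fun w : wordB H A => let: (e, es, e') := w in g e es e') r = 0.
Proof.
case: g_lin => gl gr gi g1.
case=> *; rewrite ?liftU ?scale1r ?g1 //; apply: fglift_lindef.
- exact: gl.
- exact: gr.
- exact: gi.
Qed.

Lemma lin_extB : lin (extB g).
Proof. exact: ext_linear g_rel. Qed.

Lemma extBE e es e' : extB g (genB e es e') = g e es e'.
Proof. exact: (ext_gen g_rel). Qed.
End ExtB.

(** The relations never mix words of different lengths, so linear maps chosen separately for each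
    bidegree glue. This covers [dl], [d] and [sigmabar], whose summation ranges or auxiliary maps
    depend on the lengths of the word. *)
Lemma multilinX_genX P (L : nat -> nat -> X -> P) :
  (forall s r, lin (L s r)) ->
  multilinX (fun e hs aa e' => L (size hs) (size aa) (genX e hs aa e')).
Proof.
move=> Ll; case: multilin_genX => gl gr gh ga gh1 ga1; split.
- by move=> hs aa e'; apply: (lin_comp (Ll _ _) (gl _ _ _)).
- by move=> e hs aa; apply: (lin_comp (Ll _ _) (gr _ _ _)).
- move=> e aa e' u v; apply: lin_ext (lin_comp (Ll _ _) (gh e aa e' u v)) => z.
  by rewrite size_cat /=.
- move=> e hs e' u v; apply: lin_ext (lin_comp (Ll _ _) (ga e hs e' u v)) => z.
  by rewrite size_cat /=.
- by move=> e u v aa e'; rewrite gh1 (lin0 (Ll _ _)).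
- by move=> e hs u v e'; rewrite ga1 (lin0 (Ll _ _)).
Qed.
End Modules.

Arguments multilin_genX {k H A}.
Arguments multilin_genY {k H A}.
Arguments multilin_genB {k H A}.

Lemma rcons_cat_cons (T : Type) (u v : seq T) x y :
  rcons (u ++ x :: v) y = u ++ x :: rcons v y.
Proof. by rewrite rcons_cat. Qed.

Lemma size_cat_cons (T : Type) (u v : seq T) x :
  size (u ++ x :: v) = (size u + size v).+1.
Proof. by rewrite size_cat addnS. Qed.

(** * Words given by lists that include an outer entry *)

Section Words.
Context (k : comNzRingType) (H : hopfAlgebra k) (A : algType k).
Local Notation E := (cprod H A).
Local Notation X := (X H A).
Local Notation Y := (Y H A).
Local Notation B := (B H A).
Local Notation "1E" := (cone H A).

(** Splitting the list at its right end undoes the [belast]/[last] encoding; hence the repeated use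
    of [lastP] below. *)
Lemma mkX_rcons a0 h0 hs t a h' :
  mkX a0 h0 hs (rcons t a) h' = genX (a0 # h0) hs t (a # h') :> X.
Proof. by case: t => // b t; rewrite rcons_cons /mkX belast_rcons last_rcons. Qed.

Lemma mkY_rcons a h0 hs h' :
  mkY a (h0 :: rcons hs h') = genY (a # h0) hs h' :> Y.
Proof. by case: hs => // h hs; rewrite rcons_cons /mkY belast_rcons last_rcons. Qed.

Lemma mkB_rcons e es e' : mkB (e :: rcons es e') = genB e es e' :> B.
Proof. by case: es => // x es; rewrite rcons_cons /mkB belast_rcons last_rcons. Qed.

Lemma lin_mkX_a0 h0 hs aa h' : lin (fun a0 => mkX a0 h0 hs aa h' : X).
Proof.
case/lastP: aa => [|t a]; first exact: lin_cst0.
apply: lin_ext => [z|]; first exact: mkX_rcons.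
by apply: (lin_comp (multilinX_l multilin_genX _ _ _)); lin_tac.
Qed.

Lemma lin_mkX_h0 a0 hs aa h' : lin (fun h0 => mkX a0 h0 hs aa h' : X).
Proof.
case/lastP: aa => [|t a]; first exact: lin_cst0.
apply: lin_ext => [z|]; first exact: mkX_rcons.
by apply: (lin_comp (multilinX_l multilin_genX _ _ _)); lin_tac.
Qed.

Lemma lin_mkX_h' a0 h0 hs aa : lin (mkX a0 h0 hs aa : H -> X).
Proof.
case/lastP: aa => [|t a]; first exact: lin_cst0.
apply: lin_ext => [z|]; first exact: mkX_rcons.
by apply: (lin_comp (multilinX_r multilin_genX _ _ _)); lin_tac.
Qed.

Lemma mlin_mkX_h a0 h0 aa h' : mlin (fun hs => mkX a0 h0 hs aa h' : X).
Proof.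
case/lastP: aa => [|t a] u v; first exact: lin_cst0.
by apply: lin_ext (multilinX_h multilin_genX _ _ _ u v) => z; apply: mkX_rcons.
Qed.

Lemma mlin_mkX_a a0 h0 hs h' : mlin (fun aa => mkX a0 h0 hs aa h' : X).
Proof.
move=> u v; case/lastP: v => [|v a].
  apply: lin_ext => [z|]; first by rewrite cats1; exact: mkX_rcons.
  by apply: (lin_comp (multilinX_r multilin_genX _ _ _)); lin_tac.
apply: lin_ext (multilinX_a multilin_genX _ hs _ u v) => z.
by rewrite -rcons_cat_cons mkX_rcons.
Qed.

Lemma mkX_h1 a0 h0 u v aa h' : mkX a0 h0 (u ++ 1 :: v) aa h' = 0 :> X.
Proof.
by case/lastP: aa => // t a; rewrite mkX_rcons (multilinX_h1 multilin_genX).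
Qed.

(** The last entry of the list belongs to the outer right factor, so a unit there is harmless; only
    a unit followed by something is an inner one. *)
Lemma mkX_a1 a0 h0 hs u v h' :
  v != [::] -> mkX a0 h0 hs (u ++ 1 :: v) h' = 0 :> X.
Proof.
case/lastP: v => // v a _.
by rewrite -rcons_cat_cons mkX_rcons (multilinX_a1 multilin_genX).
Qed.

Lemma lin_mkY_a hh : lin (fun a => mkY a hh : Y).
Proof.
case: hh => [|h0 t]; first exact: lin_cst0.
case/lastP: t => [|t h]; first exact: lin_cst0.
apply: lin_ext => [z|]; first exact: mkY_rcons.
by apply: (lin_comp (multilinY_l multilin_genY _ _)); lin_tac.
Qed.

Lemma mlin_mkY a : mlin (mkY a : seq H -> Y).
Proof.
case=> [|h0 u] v; case/lastP: v => [|v h].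
- exact: lin_cst0.
- apply: lin_ext => [z|]; first exact: mkY_rcons.
  by apply: (lin_comp (multilinY_l multilin_genY _ _)); lin_tac.
- apply: lin_ext (multilinY_r multilin_genY (a # h0) u) => z.
  by rewrite /= cats1 -mkY_rcons.
- apply: lin_ext (multilinY_h multilin_genY (a # h0) h u v) => z.
  by rewrite /= -rcons_cat_cons -mkY_rcons.
Qed.

Lemma mkY_1 a u v : u != [::] -> v != [::] -> mkY a (u ++ 1 :: v) = 0 :> Y.
Proof.
case: u => // h0 u _; case/lastP: v => // v h _.
by rewrite cat_cons -rcons_cat_cons mkY_rcons (multilinY_h1 multilin_genY).
Qed.

Lemma mlin_mkB : mlin (@mkB k H A).
Proof.
case=> [|e u] v; case/lastP: v => [|v e'].
- exact: lin_cst0.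
- apply: lin_ext (multilinB_l multilin_genB v e') => z; exact: mkB_rcons.
- apply: lin_ext (multilinB_r multilin_genB e u) => z.
  by rewrite /= cats1 -mkB_rcons.
- apply: lin_ext (multilinB_i multilin_genB e e' u v) => z.
  by rewrite /= -rcons_cat_cons -mkB_rcons.
Qed.

Lemma mkB_1 u v : u != [::] -> v != [::] -> mkB (u ++ 1E :: v) = 0 :> B.
Proof.
case: u => // e u _; case/lastP: v => // v e' _.
by rewrite cat_cons -rcons_cat_cons mkB_rcons (multilinB_1 multilin_genB).
Qed.

End Words.

Ltac word_tac := lin_tac;
  first [ exact: lin_mkX_a0 | exact: lin_mkX_h0 | exact: lin_mkX_h'
        | exact: mlin_mkX_h | exact: mlin_mkX_a | exact: lin_mkY_a
        | apply: (lin_comp (lin_mkX_a0 _ _ _ _)); lin_tac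
        | apply: (lin_comp (lin_mkY_a _)); lin_tac
        | apply: (lin_comp (mlin_mkY _ _ _)); lin_tac ].

(** * Multiplication on the outer factors, and the map mu *)

Section BimoduleStructure.
Context (k : comNzRingType) (H : hopfAlgebra k) (A : algType k).
Context (w : weakAction H A) (f : {linear tensor H H -> A}).
Hypothesis crossed : is_crossed_product w f.
Local Notation E := (cprod H A).
Local Notation X := (X H A).
Local Notation Y := (Y H A).
Local Notation B := (B H A).
Local Notation "1E" := (cone H A).
Local Notation cmul := (cmul w f).

Lemma lin_cmull x : lin (cmul x). Proof. by case: (bilin_cmul w f) => _; apply. Qed.
Lemma lin_cmulr x : lin (cmul^~ x). Proof. by case: (bilin_cmul w f) => + _; apply. Qed.

Lemma multilin_lmulX c : multilinX (fun e hs aa e' => genX (cmul c e) hs aa e').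
Proof.
case: (@multilin_genX k H A) => gl gr gh ga gh1 ga1; split=> [hs aa e'|||||].
- exact: lin_comp (gl _ _ _) (lin_cmull c).
- by move=> *; apply: gr.
- by move=> *; apply: gh.
- by move=> *; apply: ga.
- by move=> *; apply: gh1.
- by move=> *; apply: ga1.
Qed.

Lemma multilin_rmulX c : multilinX (fun e hs aa e' => genX e hs aa (cmul e' c)).
Proof.
case: (@multilin_genX k H A) => gl gr gh ga gh1 ga1; split=> [|e hs aa||||].
- by move=> *; apply: gl.
- exact: lin_comp (gr _ _ _) (lin_cmulr c).
- by move=> *; apply: gh.
- by move=> *; apply: ga.
- by move=> *; apply: gh1.
- by move=> *; apply: ga1.
Qed.

Lemma multilin_lmulB c : multilinB (fun e es e' => genB (cmul c e) es e').
Proof.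
case: (@multilin_genB k H A) => gl gr gi g1; split=> [es e'|||].
- exact: lin_comp (gl _ _) (lin_cmull c).
- by move=> *; apply: gr.
- by move=> *; apply: gi.
- by move=> *; apply: g1.
Qed.

Lemma multilin_rmulB c : multilinB (fun e es e' => genB e es (cmul e' c)).
Proof.
case: (@multilin_genB k H A) => gl gr gi g1; split=> [|e es||].
- by move=> *; apply: gl.
- exact: lin_comp (gr _ _) (lin_cmulr c).
- by move=> *; apply: gi.
- by move=> *; apply: g1.
Qed.

Lemma lin_lmulX c : lin (lmulX w f c).
Proof. exact: lin_extX (multilin_lmulX c). Qed.
Lemma lin_rmulX c : lin (fun x => rmulX w f x c).
Proof. exact: lin_extX (multilin_rmulX c). Qed.
Lemma lin_lmulB c : lin (lmulB w f c).
Proof. exact: lin_extB (multilin_lmulB c). Qed.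
Lemma lin_rmulB c : lin (fun x => rmulB w f x c).
Proof. exact: lin_extB (multilin_rmulB c). Qed.

Lemma lmulXE c e hs aa e' :
  lmulX w f c (genX e hs aa e') = genX (cmul c e) hs aa e'.
Proof. exact: extXE (multilin_lmulX c) _ _ _ _. Qed.
Lemma rmulXE c e hs aa e' :
  rmulX w f (genX e hs aa e') c = genX e hs aa (cmul e' c).
Proof. exact: extXE (multilin_rmulX c) _ _ _ _. Qed.
Lemma lmulBE c e es e' : lmulB w f c (genB e es e') = genB (cmul c e) es e'.
Proof. exact: extBE (multilin_lmulB c) _ _ _. Qed.
Lemma rmulBE c e es e' : rmulB w f (genB e es e') c = genB e es (cmul e' c).
Proof. exact: extBE (multilin_rmulB c) _ _ _. Qed.

(** Maps extended from words with outer factors 1 place these factors back by multiplication;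
    linearity in the multiplier is what makes the extension linear in its outer entries. *)
Lemma lin_lmulXl x : lin (fun c => lmulX w f c x).
Proof.
apply: lin_ext_param => -[[[e hs] aa] e'] /=.
exact: lin_comp (multilinX_l (@multilin_genX k H A) _ _ _) (lin_cmulr e).
Qed.

Lemma lin_rmulXr x : lin (rmulX w f x).
Proof.
apply: lin_ext_param => -[[[e hs] aa] e'] /=.
exact: lin_comp (multilinX_r (@multilin_genX k H A) _ _ _) (lin_cmull e').
Qed.

Lemma lin_rmulBr x : lin (rmulB w f x).
Proof.
apply: lin_ext_param => -[[e es] e'] /=.
exact: lin_comp (multilinB_r (@multilin_genB k H A) _ _) (lin_cmull e').
Qed.

Definition mu_word (e : E) (hs : seq H) (aa : seq A) (e' : E) : Y :=
  if aa is [::] then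
    cplift (fun a0 h0 => cplift (fun a1 h' =>
      sw2 h0 (fun x y => swl hs (fun u v =>
        genY ((a0 * wactl w (x :: u) a1) # y) v h'))) e') e
  else 0.

Lemma multilin_mu : multilinX mu_word.
Proof.
case: (@multilin_genY k H A) => gl gr gh gh1.
split=> /=.
- move=> hs [|? ?] e'; last exact: lin_cst0.
  by rewrite /mu_word; lin_tac; apply: (lin_comp (gl _ _)); lin_tac.
- move=> e hs [|? ?]; last exact: lin_cst0.
  by rewrite /mu_word; lin_tac; first [exact: gr | apply: (lin_comp (gl _ _)); lin_tac].
- move=> e [|? ?] e' u v; last exact: lin_cst0.
  apply: lin_cplift_param => a0 h0.
  apply: lin_cplift_param => a1 h'; apply: lin_sw2_param => x y.
  apply: mlin_swl => [v'|u'] p q; last exact: gh.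
  by apply: (lin_comp (gl _ _)); lin_tac.
- by move=> e hs e' [|? ?] v; apply: lin_cst0.
- move=> e u v [|? ?] e' //; apply: cplift0 => a0 h0; apply: cplift0 => a1 h'.
  apply: tlift0 => x y; apply: swl_unit => [v' p q|u'|u' p q _].
  + by apply: (lin_comp (gl _ _)); lin_tac.
  + exact: gh.
  + exact: gh1.
- by move=> e hs [|? ?] v.
Qed.

Lemma lin_mu : lin (mu w). Proof. exact: lin_extX multilin_mu. Qed.
Lemma muE e hs aa e' : mu w (genX e hs aa e') = mu_word e hs aa e'.
Proof. exact: extXE multilin_mu _ _ _ _. Qed.

End BimoduleStructure.

(** * The column differential d^0 *)

Section ColumnDifferential.
Context (k : comNzRingType) (H : hopfAlgebra k) (A : algType k).
Context (w : weakAction H A) (f : {linear tensor H H -> A}).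
Hypothesis crossed : is_crossed_product w f.
Local Notation E := (cprod H A).
Local Notation X := (X H A).
Local Notation Y := (Y H A).
Local Notation B := (B H A).
Local Notation "1E" := (cone H A).
Local Notation cmul := (cmul w f).

Local Arguments wactl : simpl never.

Definition d0_act (a0 : A) (h0 : H) (hs : seq H) (l : seq A) (h' : H) : X :=
  if l is a1 :: t then
    sw2 h0 (fun x y => swl hs (fun u v =>
      mkX (a0 * wactl w (x :: u) a1) y v t h'))
  else 0.

Local Arguments d0_act : simpl never.

Definition d0_merge (a0 : A) (h0 : H) (hs : seq H) (h' : H)
    (u : seq A) (a b : A) (v : seq A) : X :=
  mkX a0 h0 hs (u ++ a * b :: v) h'.

Definition d0_body (a0 : A) (h0 : H) (hs : seq H) (l : seq A) (h' : H) : X :=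
  d0_act a0 h0 hs l h' +
  \sum_(i < (size l).-1) (-1) ^+ i.+1 *: adj (d0_merge a0 h0 hs h') i l.

(** The A-part of the right factor joins the list, so that a_1, ..., a_(r+1) are treated alike. The
    case r = 0 needs no separate clause, since [mkX] is 0 on the empty list. *)
Definition d0_word (e : E) (hs : seq H) (aa : seq A) (e' : E) : X :=
  cplift (fun a0 h0 => cplift (fun a' h' =>
    d0_body a0 h0 hs (rcons aa a') h') e') e.

Lemma d0_extX : d0 w = extX d0_word.
Proof.
congr extX; apply/funext => e; apply/funext => hs; apply/funext => aa.
apply/funext => e'; case: aa => [|a1 t] /=.
  symmetry; apply: cplift0 => a0 h0; apply: cplift0 => a' h'.
  rewrite /d0_body big_ord0 addr0; apply: tlift0 => x y.
  by apply: swl0 => u v.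
by apply: eq_cplift => a0 h0; apply: eq_cplift => a' h'; rewrite /d0_body /= size_rcons.
Qed.

Lemma lin_d0_act_a0 h0 hs l h' : lin (fun a0 => d0_act a0 h0 hs l h').
Proof. by case: l => [|a t]; rewrite /d0_act; [lin_tac | word_tac]. Qed.

Lemma lin_d0_act_h0 a0 hs l h' : lin (fun h0 => d0_act a0 h0 hs l h').
Proof. by case: l => [|a t]; rewrite /d0_act; [lin_tac | word_tac]. Qed.

Lemma lin_d0_act_h' a0 h0 hs l : lin (d0_act a0 h0 hs l).
Proof. by case: l => [|a t]; rewrite /d0_act; [lin_tac | word_tac]. Qed.

Lemma mlin_d0_act_h a0 h0 l h' : mlin (fun hs => d0_act a0 h0 hs l h').
Proof.
case: l => [|a t] u v; first exact: lin_cst0.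
apply: lin_sw2_param => x y; apply: mlin_swl => [v'|u'] p q.
  by word_tac.
exact: mlin_mkX_h.
Qed.

Lemma mlin_d0_act_a a0 h0 hs h' : mlin (fun l => d0_act a0 h0 hs l h').
Proof.
case=> [|a u] v; rewrite /d0_act /=; first by word_tac.
by lin_tac; apply: mlin_mkX_a.
Qed.

Lemma d0_act_h1 a0 h0 u v l h' : d0_act a0 h0 (u ++ 1 :: v) l h' = 0.
Proof.
case: l => // a t; apply: tlift0 => x y; apply: swl_unit => [v' p q|u'|u' p q _].
- by word_tac.
- exact: mlin_mkX_h.
- exact: mkX_h1.
Qed.

(** Acting on 1 only produces counits, and these undo the comultiplication of h_0, ..., h_s. *)
Lemma d0_act_1 a0 h0 hs t h' : d0_act a0 h0 hs (1 :: t) h' = mkX a0 h0 hs t h'.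
Proof.
rewrite -[RHS](sw2_counitl h0 (lin_mkX_h0 _ _ _ _)).
apply: eq_tlift => x y.
rewrite -[mkX a0 y hs t h'](swl_counit hs (mlin_mkX_h a0 y t h')).
apply: etrans (esym (swl_comp hs _ (lin_scale (counit H x) (@lin_id k X)))).
apply: eq_swl => u v _ _; rewrite wactl_1 scalerA big_cons.
rewrite -scalerAr mulr1 -[_ *: a0]addr0 lin_mkX_a0.
by rewrite (lin0 (lin_mkX_a0 _ _ _ _)) addr0.
Qed.

Lemma lin_d0_body_a0 h0 hs l h' : lin (fun a0 => d0_body a0 h0 hs l h').
Proof.
apply: lin_add; first exact: lin_d0_act_a0.
by apply: lin_sum => i _; apply: lin_scale; apply: lin_mkX_a0.
Qed.

Lemma lin_d0_body_h0 a0 hs l h' : lin (fun h0 => d0_body a0 h0 hs l h').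
Proof.
apply: lin_add; first exact: lin_d0_act_h0.
by apply: lin_sum => i _; apply: lin_scale; apply: lin_mkX_h0.
Qed.

Lemma lin_d0_body_h' a0 h0 hs l : lin (d0_body a0 h0 hs l).
Proof.
apply: lin_add; first exact: lin_d0_act_h'.
by apply: lin_sum => i _; apply: lin_scale; apply: lin_mkX_h'.
Qed.

Lemma mlin_d0_body_h a0 h0 l h' : mlin (fun hs => d0_body a0 h0 hs l h').
Proof.
move=> u v; apply: lin_add; first exact: mlin_d0_act_h.
by apply: lin_sum => i _; apply: lin_scale; apply: mlin_mkX_h.
Qed.

Lemma mlin_d0_body_a a0 h0 hs h' : mlin (fun l => d0_body a0 h0 hs l h').
Proof.
move=> u v; apply: lin_add; first exact: mlin_d0_act_a.
apply: lin_ext => [z|]; first by rewrite size_cat /= addnS.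
apply: lin_sum => i _; apply: lin_scale; apply: lin_adj => //.
- move=> a b v' p q; rewrite /d0_merge; apply: lin_ext => [z|].
    by rewrite -catA cat_cons.
  exact: mlin_mkX_a.
- by move=> u' b v'; apply: lin_comp (mlin_mkX_a _ _ _ _ _ _) (lin_mulr _ (@lin_id _ _)).
- by move=> u' a v'; apply: lin_comp (mlin_mkX_a _ _ _ _ _ _) (lin_mull _ (@lin_id _ _)).
- move=> u' a b p q; rewrite /d0_merge; apply: lin_ext => [z|].
    by rewrite -cat_cons catA.
  exact: mlin_mkX_a.
Qed.

Lemma d0_body_h1 a0 h0 u v l h' : d0_body a0 h0 (u ++ 1 :: v) l h' = 0.
Proof.
rewrite /d0_body d0_act_h1 add0r big1 // => i _.
by rewrite /adj /d0_merge mkX_h1 scaler0.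
Qed.

(** If the unit comes first, the action term equals the word without it and cancels against the
    first merge, which has sign -1; the later merges keep an inner unit. Otherwise the action term
    already contains an inner unit, and the merges cancel by [adj_sum]. *)
Lemma d0_body_a1 a0 h0 hs u v h' :
  v != [::] -> d0_body a0 h0 hs (u ++ 1 :: v) h' = 0.
Proof.
move=> v0; rewrite /d0_body size_cat /= addnS /=.
case: (eqVneq u [::]) => [->|u0] /=.
  rewrite d0_act_1; case: v v0 => // a v _; rewrite big_ord_recl expr1 scaleN1r.
  rewrite {1}/adj /d0_merge /= drop0 mul1r addrA subrr add0r big1 // => i _.
  rewrite (_ : adj _ _ _ = 0) ?scaler0 //.
  by apply: (@mkX_a1 _ _ _ _ _ _ [::]); case: (nat_of_ord i).
have -> : d0_act a0 h0 hs (u ++ 1 :: v) h' = 0.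
  case: u u0 => // a u _; apply: tlift0 => x y; apply: swl0 => u' v' _ _.
  exact: mkX_a1.
rewrite add0r; apply/eqP; rewrite -oppr_eq0 -sumrN; apply/eqP.
rewrite -[RHS](adj_sum (D := d0_merge a0 h0 hs h') (one := 1) _ _ _ u0 v0).
- by apply: eq_bigr => i _; rewrite exprS mulN1r scaleNr opprK.
- by move=> p q a b r _; rewrite /d0_merge -catA; apply: mkX_a1; case: (q).
- move=> p a b q r r0; rewrite /d0_merge -cat_cons catA; exact: mkX_a1.
- by move=> p a b q; rewrite /d0_merge mulr1 mul1r cat_rcons.
Qed.

Lemma multilin_d0 : multilinX d0_word.
Proof.
split.
- move=> hs aa e'; rewrite /d0_word; lin_tac.
    exact: lin_d0_body_a0.
  exact: lin_d0_body_h0.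
- move=> e hs aa; rewrite /d0_word; lin_tac; last exact: lin_d0_body_h'.
  apply: lin_ext (mlin_d0_body_a _ _ _ _ aa [::]) => z; by rewrite cats1.
- move=> e aa e' u v; rewrite /d0_word; lin_tac; exact: mlin_d0_body_h.
- move=> e hs e' u v; apply: lin_cplift_param => a0 h0.
  apply: lin_cplift_param => a' h'.
  apply: lin_ext (mlin_d0_body_a a0 h0 hs h' u (rcons v a')) => z.
  by rewrite rcons_cat_cons.
- move=> e u v aa e'; apply: cplift0 => a0 h0; apply: cplift0 => a' h'.
  exact: d0_body_h1.
- move=> e hs u v e'; apply: cplift0 => a0 h0; apply: cplift0 => a' h'.
  by rewrite rcons_cat_cons d0_body_a1 //; case: (v).
Qed.

Lemma lin_d0 : lin (d0 w). Proof. by rewrite d0_extX; apply: lin_extX multilin_d0. Qed.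
Lemma d0E e hs aa e' : d0 w (genX e hs aa e') = d0_word e hs aa e'.
Proof. by rewrite d0_extX; apply: extXE multilin_d0 _ _ _ _. Qed.

End ColumnDifferential.

(** * The maps partial, sigma^0, sigma^(-1), xi and b' *)

Section ElementaryMaps.
Context (k : comNzRingType) (H : hopfAlgebra k) (A : algType k).
Context (w : weakAction H A) (f : {linear tensor H H -> A}).
Hypothesis crossed : is_crossed_product w f.
Local Notation E := (cprod H A).
Local Notation X := (X H A).
Local Notation Y := (Y H A).
Local Notation B := (B H A).
Local Notation "1E" := (cone H A).
Local Notation cmul := (cmul w f).

Definition partial_term (a : A) (u : seq H) (x y : H) (v : seq H) : Y :=
  swl u (fun u1 u2 => sw2 x (fun x1 x2 => sw2 y (fun y1 y2 =>
    mkY (a * wactl w u1 (f (x1 \ox y1))) (u2 ++ (x2 * y2) :: v)))).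

Lemma lin_partial_term_a u x y v : lin (fun a => partial_term a u x y v).
Proof. by rewrite /partial_term; word_tac. Qed.

Lemma lin_partial_term_x a u y v : lin (fun x => partial_term a u x y v).
Proof. by rewrite /partial_term; word_tac. Qed.

Lemma lin_partial_term_y a u x v : lin (fun y => partial_term a u x y v).
Proof. by rewrite /partial_term; word_tac. Qed.

Lemma mlin_partial_term_u a x y v : mlin (fun u => partial_term a u x y v).
Proof.
apply: mlin_swl => [v'|u'] p q; first by word_tac.
lin_tac; apply: lin_ext => [z|]; first by rewrite -catA cat_cons.
exact: mlin_mkY.
Qed.

Lemma mlin_partial_term_v a u x y : mlin (partial_term a u x y).
Proof.
move=> p q; rewrite /partial_term; lin_tac.
apply: lin_ext => [z|]; first by rewrite -cat_cons catA.
exact: mlin_mkY.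
Qed.

Lemma partial_term_u1 a u u' x y v :
  u != [::] -> partial_term a (u ++ 1 :: u') x y v = 0.
Proof.
move=> u0; apply: swl_unit => [v'|u1|u1 p q zu].
- by move=> p q; word_tac.
- move=> p q; lin_tac; apply: lin_ext => [z|]; first by rewrite -catA cat_cons.
  exact: mlin_mkY.
apply: tlift0 => x1 x2; apply: tlift0 => y1 y2.
rewrite -catA; apply: mkY_1; last by case: (q).
by rewrite -size_eq0 zu size_eq0.
Qed.

Lemma partial_term_v1 a u x y v v' :
  v' != [::] -> partial_term a u x y (v ++ 1 :: v') = 0.
Proof.
move=> v0; apply: swl0 => u1 u2 _ _.
apply: tlift0 => x1 x2; apply: tlift0 => y1 y2.
by rewrite -cat_cons catA mkY_1 //; case: (u2).
Qed.

Lemma partial_term_scale a b u v (l : seq H) :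
  mkY (a * wactl w u (b *: 1)) (v ++ l) =
  (b * \prod_(h <- u) counit H h) *: mkY a (v ++ l) :> Y.
Proof.
rewrite -[b *: 1]addr0 lin_wactl (lin0 (lin_wactl w u)) addr0 wactl_1 scalerA.
rewrite -scalerAr mulr1 -[_ *: a]addr0 lin_mkY_a.
by rewrite (lin0 (lin_mkY_a _)) addr0.
Qed.

(** The cocycle at a unit is a counit and the action on scalars gives further counits; all
    comultiplications contract. With the mirror statement [partial_term_l1] this yields the
    hypothesis [Dxy1] of [adj_sum]. *)
Lemma partial_term_r1 a u x v :
  partial_term a u x 1 v = mkY a (u ++ x :: v).
Proof.
rewrite -[RHS](swl_counit u (G := fun u => mkY a (u ++ x :: v))); last first.
  move=> p q; apply: lin_ext => [z|]; first by rewrite -catA cat_cons.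
  exact: mlin_mkY.
apply: eq_swl => u1 u2 _ _.
have Gl : lin (fun y => (\prod_(h <- u1) counit H h : k) *: (mkY a (u2 ++ y :: v) : Y)).
  by apply: lin_scale; apply: mlin_mkY.
rewrite -[RHS](sw2_counitl x Gl).
apply: eq_tlift => x1 x2; rewrite sw2_1; last by word_tac.
by rewrite mulr1 (cocycle_1r crossed) partial_term_scale scalerA.
Qed.

Lemma partial_term_l1 a u y v :
  partial_term a u 1 y v = mkY a (u ++ y :: v).
Proof.
rewrite -[RHS](swl_counit u (G := fun u => mkY a (u ++ y :: v))); last first.
  move=> p q; apply: lin_ext => [z|]; first by rewrite -catA cat_cons.
  exact: mlin_mkY.
apply: eq_swl => u1 u2 _ _.
have Gl : lin (fun y => (\prod_(h <- u1) counit H h : k) *: (mkY a (u2 ++ y :: v) : Y)).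
  by apply: lin_scale; apply: mlin_mkY.
rewrite -[RHS](sw2_counitl y Gl) sw2_1; last by word_tac.
apply: eq_tlift => y1 y2.
by rewrite mul1r (cocycle_1l crossed) partial_term_scale scalerA.
Qed.

Definition partial_word (e : E) (hs : seq H) (h' : H) : Y :=
  cplift (fun a h0 => \sum_(i < (size hs).+1)
    (-1) ^+ i.+1 *: adj (partial_term a) i (h0 :: rcons hs h')) e.

Lemma lin_adj_partial a i u v : (i < size u + size v)%N ->
  lin (fun z => adj (partial_term a) i (u ++ z :: v)).
Proof.
apply: lin_adj => *.
- exact: mlin_partial_term_u.
- exact: lin_partial_term_x.
- exact: lin_partial_term_y.
- exact: mlin_partial_term_v.
Qed.

Lemma multilin_partial : multilinY partial_word.
Proof.
split.
- move=> hs h'; apply: lin_cplift (@lin_id _ _); split=> [h0|a].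
    apply: lin_sum => i _; apply: lin_scale; exact: lin_partial_term_a.
  apply: lin_sum => i _; apply: lin_scale.
  by apply: (@lin_adj_partial a i [::] (rcons hs h')); rewrite size_rcons.
- move=> e hs; apply: lin_cplift_param => a h0.
  apply: lin_sum => i _; apply: lin_scale.
  apply: lin_ext (@lin_adj_partial a i (h0 :: hs) [::] _) => [z|].
    by rewrite -rcons_cons -cats1.
  by rewrite addn0.
- move=> e h' u v; apply: lin_cplift_param => a h0.
  rewrite /partial_word; apply: lin_ext => [z|]; first by rewrite size_cat_cons.
  apply: lin_sum => i _; apply: lin_scale.
  apply: lin_ext (@lin_adj_partial a i (h0 :: u) (rcons v h') _) => [z|].
    by rewrite rcons_cat_cons.
  by rewrite size_rcons addnS.
- move=> e u v h'; apply: cplift0 => a h0; rewrite rcons_cat_cons -cat_cons.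
  have -> : (size (u ++ 1 :: v)).+1 = (size (h0 :: u) + size (rcons v h'))%N.
    by rewrite size_cat size_rcons.
  under eq_bigr do rewrite exprS mulN1r scaleNr.
  rewrite sumrN adj_sum ?oppr0 // => *.
  - exact: partial_term_u1.
  - exact: partial_term_v1.
  - by rewrite partial_term_r1 partial_term_l1 cat_rcons.
  - by case: (v).
Qed.

Lemma lin_partial : lin (partial w f). Proof. exact: lin_extY multilin_partial. Qed.
Lemma partialE e hs h' : partial w f (genY e hs h') = partial_word e hs h'.
Proof. exact: extYE multilin_partial _ _ _. Qed.

Lemma multilin_sigma0Y :
  multilinY (fun e hs h' => genX e hs [::] (1 # h') : X).
Proof.
case: (@multilin_genX k H A) => gl gr gh ga gh1 ga1; split.
- by move=> *; apply: gl.
- by move=> e hs; apply: (lin_comp (gr _ _ _)); lin_tac.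
- by move=> *; apply: gh.
- by move=> *; apply: gh1.
Qed.

Lemma lin_sigma0Y : lin (@sigma0Y k H A).
Proof. exact: lin_extY multilin_sigma0Y. Qed.
Lemma sigma0YE e hs h' : sigma0Y (genY e hs h') = genX e hs [::] (1 # h') :> X.
Proof. exact: extYE multilin_sigma0Y _ _ _. Qed.

Definition sigma0X_word (e : E) (hs : seq H) (aa : seq A) (e' : E) : X :=
  (-1) ^+ (size aa).+1 *: cplift (fun a h => genX e hs (rcons aa a) (1 # h)) e'.

Lemma bilin_sigma0X e hs aa :
  bilin (fun a h => genX e hs (rcons aa a) (1 # h) : X).
Proof.
split=> [h|a]; last by apply: (lin_comp (multilinX_r multilin_genX _ _ _)); lin_tac.
by apply: lin_ext (multilinX_a multilin_genX _ _ _ aa [::]) => z; rewrite cats1.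
Qed.

Lemma multilin_sigma0X : multilinX sigma0X_word.
Proof.
case: (@multilin_genX k H A) => gl gr gh ga gh1 ga1; split.
- by move=> hs aa e'; apply: lin_scale; apply: lin_cplift_param => a h; apply: gl.
- move=> e hs aa; apply: lin_scale; apply: lin_cplift (@lin_id _ _).
  exact: bilin_sigma0X.
- by move=> e aa e' u v; apply: lin_scale; apply: lin_cplift_param => a h; apply: gh.
- move=> e hs e' u v.
  apply: lin_ext (lin_scale ((-1) ^+ (size u + (size v).+1).+1) (_ : lin (fun z =>
    cplift (fun a h => genX e hs (u ++ z :: rcons v a) (1 # h) : X) e'))) => [z|].
    rewrite /sigma0X_word size_cat /=; congr (_ *: _).
    by apply: eq_cplift => a h; rewrite rcons_cat_cons.
  by apply: lin_cplift_param => a h; apply: ga.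
- by move=> e u v aa e'; rewrite /sigma0X_word cplift0 ?scaler0.
- move=> e hs u v e'; rewrite /sigma0X_word cplift0 ?scaler0 // => a h.
  by rewrite rcons_cat_cons ga1.
Qed.

Lemma lin_sigma0X : lin (@sigma0X k H A).
Proof. exact: lin_extX multilin_sigma0X. Qed.
Lemma sigma0XE e hs aa e' : sigma0X (genX e hs aa e') = sigma0X_word e hs aa e'.
Proof. exact: extXE multilin_sigma0X _ _ _ _. Qed.

Lemma multilin_sigmam1 :
  multilinY (fun e hs h' => (-1) ^+ size hs *: genY e (rcons hs h') 1 : Y).
Proof.
case: (@multilin_genY k H A) => gl gr gh gh1; split.
- by move=> hs h'; apply: lin_scale; apply: gl.
- move=> e hs; apply: lin_scale.
  by apply: lin_ext (gh _ _ hs [::]) => z; rewrite cats1.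
- move=> e h' u v.
  apply: lin_ext (lin_scale ((-1) ^+ (size u + (size v).+1)) (gh e 1 u (rcons v h'))) => z.
  by rewrite size_cat rcons_cat_cons.
- by move=> e u v h'; rewrite rcons_cat_cons gh1 scaler0.
Qed.

Lemma lin_sigmam1 : lin (@sigmam1 k H A).
Proof. exact: lin_extY multilin_sigmam1. Qed.
Lemma sigmam1E e hs h' :
  sigmam1 (genY e hs h') = (-1) ^+ size hs *: genY e (rcons hs h') 1 :> Y.
Proof. exact: extYE multilin_sigmam1 _ _ _. Qed.

Lemma multilin_xi :
  multilinB (fun e es e' => (-1) ^+ (size es).+1 *: genB e (rcons es e') 1E : B).
Proof.
case: (@multilin_genB k H A) => gl gr gi g1; split.
- by move=> es e'; apply: lin_scale; apply: gl.
- move=> e es; apply: lin_scale.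
  by apply: lin_ext (gi _ _ es [::]) => z; rewrite cats1.
- move=> e e' u v.
  apply: lin_ext (lin_scale ((-1) ^+ (size u + (size v).+1).+1) (gi e 1E u (rcons v e'))) => z.
  by rewrite size_cat rcons_cat_cons.
- by move=> e u v e'; rewrite rcons_cat_cons g1 scaler0.
Qed.

Lemma lin_xi : lin (@xi k H A).
Proof. exact: lin_extB multilin_xi. Qed.
Lemma xiE e es e' :
  xi (genB e es e') = (-1) ^+ (size es).+1 *: genB e (rcons es e') 1E :> B.
Proof. exact: extBE multilin_xi _ _ _. Qed.

Definition bprime_term (u : seq E) (x y : E) (v : seq E) : B :=
  mkB (u ++ cmul x y :: v).

Definition bprime_word (e : E) (es : seq E) (e' : E) : B :=
  \sum_(i < (size es).+1) (-1) ^+ i *: adj bprime_term i (e :: rcons es e').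

Lemma lin_adj_bprime i u v : (i < size u + size v)%N ->
  lin (fun z => adj bprime_term i (u ++ z :: v)).
Proof.
apply: lin_adj.
- move=> x y v' p q; rewrite /bprime_term; apply: lin_ext => [z|].
    by rewrite -catA cat_cons.
  exact: mlin_mkB.
- by move=> u' y v'; apply: lin_comp (mlin_mkB _ _) (lin_cmulr w f y).
- by move=> u' x v'; apply: lin_comp (mlin_mkB _ _) (lin_cmull w f x).
- move=> u' x y p q; rewrite /bprime_term; apply: lin_ext => [z|].
    by rewrite -cat_cons catA.
  exact: mlin_mkB.
Qed.

Lemma multilin_bprime : multilinB bprime_word.
Proof.
split.
- move=> es e'; apply: lin_sum => i _; apply: lin_scale.
  by apply: (@lin_adj_bprime i [::] (rcons es e')); rewrite size_rcons.
- move=> e es; apply: lin_sum => i _; apply: lin_scale.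
  apply: lin_ext (@lin_adj_bprime i (e :: es) [::] _) => [z|].
    by rewrite -rcons_cons -cats1.
  by rewrite addn0.
- move=> e e' u v.
  rewrite /bprime_word; apply: lin_ext => [z|]; first by rewrite size_cat_cons.
  apply: lin_sum => i _; apply: lin_scale.
  apply: lin_ext (@lin_adj_bprime i (e :: u) (rcons v e') _) => [z|].
    by rewrite rcons_cat_cons.
  by rewrite size_rcons addnS.
- move=> e u v e'; rewrite /bprime_word rcons_cat_cons -cat_cons.
  have -> : (size (u ++ 1E :: v)).+1 = (size (e :: u) + size (rcons v e'))%N.
    by rewrite size_cat size_rcons.
  rewrite adj_sum // => [p q x y r p0|p x y q r r0|p x y q|].
  - by rewrite /bprime_term -catA mkB_1 //; case: (q).
  - by rewrite /bprime_term -cat_cons catA mkB_1 //; case: (p).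
  - by rewrite /bprime_term cmule1 // cmul1e // cat_rcons.
  - by case: (v).
Qed.

Lemma lin_bprime : lin (bprime w f). Proof. exact: lin_extB multilin_bprime. Qed.
Lemma bprimeE e es e' : bprime w f (genB e es e') = bprime_word e es e'.
Proof. exact: extBE multilin_bprime _ _ _. Qed.

End ElementaryMaps.

(** * Spans of words and degrees of the elementary maps *)

Section Homogeneity.
Context (k : comNzRingType) (H : hopfAlgebra k) (A : algType k).
Context (w : weakAction H A) (f : {linear tensor H H -> A}).
Hypothesis crossed : is_crossed_product w f.
Local Notation E := (cprod H A).
Local Notation X := (X H A).
Local Notation Y := (Y H A).
Local Notation B := (B H A).
Local Notation "1E" := (cone H A).
Local Notation cmul := (cmul w f).

(** The left factor is left free: neither the lengths nor the condition on the last factor involves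
    it. *)
Definition spanX (P : seq H -> seq A -> E -> Prop) : X -> Prop :=
  kspan (fun x => exists e hs aa e', P hs aa e' /\ x = genX e hs aa e').

Lemma spanX_gen (P : seq H -> seq A -> E -> Prop) e hs aa e' :
  P hs aa e' -> spanX P (genX e hs aa e').
Proof. by move=> Pw; apply: kspan_mem; exists e, hs, aa, e'. Qed.

Lemma spanX_lin (M : lmodType k) (P : seq H -> seq A -> E -> Prop)
    (G : M -> Prop) (L : X -> M) x : lin L ->
  (forall e hs aa e', P hs aa e' -> kspan G (L (genX e hs aa e'))) ->
  spanX P x -> kspan G (L x).
Proof. by move=> Ll LG; apply: kspan_lin => // _ [e [hs [aa [e' [/LG + ->]]]]]. Qed.

Lemma spanX_mono (P Q : seq H -> seq A -> E -> Prop) x :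
  (forall hs aa e', P hs aa e' -> Q hs aa e') -> spanX P x -> spanX Q x.
Proof. by move=> PQ; apply: spanX_lin => // e hs aa e' /PQ; apply: spanX_gen. Qed.

(** Shape of a right-linear extension: L sees words with last factor 1, R multiplies the true last
    factor back, and c selects the summands on which the map is not 0. [phi] has this form; [psi]
    and [omega] have the analogous one on B, and [dgen] the two-sided one. *)
Lemma multilinX_right (M : lmodType k) (c : nat -> nat -> bool) (L : X -> M)
    (R : M -> E -> M) :
  lin L -> (forall e, lin (R^~ e)) -> (forall x, lin (R x)) ->
  multilinX (fun e hs aa e' =>
    if c (size hs) (size aa) then R (L (genX e hs aa 1E)) e' else 0).
Proof.
case: (@multilin_genX k H A) => gl gr gh ga gh1 ga1 Ll Rl Rr; split.
- move=> hs aa e'; apply: lin_if.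
  exact: (lin_comp (Rl e') (lin_comp Ll (gl _ _ _))).
- by move=> e hs aa; apply: lin_if (Rr _).
- move=> e aa e' u v; apply: lin_ext => [z|]; first by rewrite size_cat_cons.
  apply: lin_if.
  exact: (lin_comp (Rl e') (lin_comp Ll (gh _ _ _ _ _))).
- move=> e hs e' u v; apply: lin_ext => [z|]; first by rewrite size_cat_cons.
  apply: lin_if.
  exact: (lin_comp (Rl e') (lin_comp Ll (ga _ _ _ _ _))).
- by move=> e u v aa e'; rewrite gh1 (lin0 Ll) (lin0 (Rl _)) if_same.
- by move=> e hs u v e'; rewrite ga1 (lin0 Ll) (lin0 (Rl _)) if_same.
Qed.

Lemma multilinB_right (M : lmodType k) (c : nat -> bool) (L : B -> M)
    (R : M -> E -> M) :
  lin L -> (forall e, lin (R^~ e)) -> (forall x, lin (R x)) ->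
  multilinB (fun e es e' =>
    if c (size es) then R (L (genB e es 1E)) e' else 0).
Proof.
case: (@multilin_genB k H A) => gl gr gi g1 Ll Rl Rr; split.
- move=> es e'; apply: lin_if.
  exact: (lin_comp (Rl e') (lin_comp Ll (gl _ _))).
- by move=> e es; apply: lin_if (Rr _).
- move=> e e' u v; apply: lin_ext => [z|]; first by rewrite size_cat_cons.
  apply: lin_if.
  exact: (lin_comp (Rl e') (lin_comp Ll (gi _ _ _ _))).
- by move=> e u v e'; rewrite g1 (lin0 Ll) (lin0 (Rl _)) if_same.
Qed.

Lemma multilinX_bimod (c : nat -> nat -> bool) (L : X -> X) : lin L ->
  multilinX (fun e hs aa e' => if c (size hs) (size aa)
    then lmulX w f e (rmulX w f (L (genX 1E hs aa 1E)) e') else 0).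
Proof.
case: (@multilin_genX k H A) => gl gr gh ga gh1 ga1 Ll.
have Rl := lin_rmulX w f; have Rr := lin_rmulXr w f; split.
- move=> hs aa e'; apply: lin_if.
  exact: lin_lmulXl.
- move=> e hs aa; apply: lin_if.
  exact: (lin_comp (lin_lmulX w f e) (Rr _)).
- move=> e aa e' u v; apply: lin_ext => [z|]; first by rewrite size_cat_cons.
  apply: lin_if.
  exact: (lin_comp (lin_lmulX w f e)
    (lin_comp (Rl e') (lin_comp Ll (gh _ _ _ _ _)))).
- move=> e hs e' u v; apply: lin_ext => [z|]; first by rewrite size_cat_cons.
  apply: lin_if.
  exact: (lin_comp (lin_lmulX w f e)
    (lin_comp (Rl e') (lin_comp Ll (ga _ _ _ _ _)))).
- move=> e u v aa e'.
  by rewrite gh1 (lin0 Ll) (lin0 (Rl _)) (lin0 (lin_lmulX w f _)) if_same.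
- move=> e hs u v e'.
  by rewrite ga1 (lin0 Ll) (lin0 (Rl _)) (lin0 (lin_lmulX w f _)) if_same.
Qed.

(* [F] maps X_rs to X_(r+l-1, s-l), hence to 0 if l > s or r + l = 0. *)
Definition homog (l : nat) (F : X -> X) : Prop :=
  lin F /\ forall e hs aa e', spanX (fun hs1 aa1 _ =>
    (size hs1 + l = size hs)%N /\ ((size aa1).+1 = size aa + l)%N)
  (F (genX e hs aa e')).

Lemma homog_opp l F : homog l F -> homog l (fun x => - F x).
Proof.
case=> Fl FP; split=> [|e hs aa e']; first exact: lin_opp.
exact/kspanN/FP.
Qed.

Lemma homog_add l F G : homog l F -> homog l G -> homog l (fun x => F x + G x).
Proof.
case=> Fl FP [Gl GP]; split=> [|e hs aa e']; first exact: lin_add.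
by apply: kspanD; [apply: FP | apply: GP].
Qed.

Lemma homog_sum l (I : eqType) (r : seq I) (P : pred I) (F : I -> X -> X) :
  (forall i, i \in r -> P i -> homog l (F i)) ->
  homog l (fun x => \sum_(i <- r | P i) F i x).
Proof.
move=> FP; split=> [|e hs aa e'].
  apply: lin_ext => [x|]; first exact: big_seq_cond.
  by apply: lin_sum => i /andP[ir Pi]; case: (FP i ir Pi).
apply: kspan_sum => i ir Pi; case: (FP i ir Pi) => _ FPi. exact: FPi.
Qed.

Lemma sigma0X_span (P : seq H -> seq A -> E -> Prop) x :
  spanX P x -> spanX (fun hs aa e' => exists t e'',
    [/\ P hs t e'', (size aa = (size t).+1)%N & in_base e'' -> in_base e'])
    (sigma0X x).
Proof.
apply: spanX_lin => [|e hs aa e' Pw]; first exact: lin_sigma0X.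
rewrite sigma0XE; apply: kspanZ.
(* For a last factor in A the lift is evaluated at a # 1. Expanding along a representative would
   give terms that need not lie in A individually, and is done only when nothing about A is
   claimed. *)
have [[a e'E]|nb] := pselect (in_base e').
  rewrite e'E cpliftE; last exact: bilin_sigma0X.
  apply: spanX_gen; exists aa, e'; split=> // [|_]; first by rewrite size_rcons.
  by exists 1.
apply: cplift_kspan => a h; apply: spanX_gen; exists aa, e'.
by rewrite size_rcons.
Qed.

(** Each of F and G contributes -1 to r besides its own l, and [sigma0X] gives one back. This is the
    degree count behind every term of the recursion for d^l. *)
Lemma homog_comp l1 l2 F G : homog l1 F -> homog l2 G ->
  homog (l1 + l2)%N (fun x => sigma0X (F (G x))).
Proof.
case=> Fl FP [Gl GP]; split.
  exact: (lin_comp (@lin_sigma0X k H A) (lin_comp Fl Gl)).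
move=> e hs aa e'; move: (GP e hs aa e').
apply: (spanX_lin (lin_comp (@lin_sigma0X k H A) Fl)).
move=> e1 hs1 aa1 e1' [szh sza]; move: (sigma0X_span (FP e1 hs1 aa1 e1')).
apply: spanX_mono => hs2 aa2 e2 [t [e3 [[szh2 szt] sza2 _]]]; lia.
Qed.

Lemma size_merge_at (T : Type) (mul : T -> T -> T) x0 i (s : seq T) :
  (i.+1 < size s)%N -> (size (merge_at mul x0 i s)).+1 = size s.
Proof.
move=> lt_i; rewrite /merge_at size_cat /= size_drop size_take (ltnW lt_i); lia.
Qed.

Lemma mkX_span a0 h0 hs l h' :
  spanX (fun hs1 aa1 e' =>
    [/\ hs1 = hs, (size aa1).+1 = size l & exists a, e' = a # h'])
  (mkX a0 h0 hs l h').
Proof.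
case/lastP: l => [|l a]; first exact: kspan0.
by rewrite mkX_rcons; apply: spanX_gen; split; rewrite ?size_rcons //; exists a.
Qed.

Lemma d0_body_span a0 h0 hs l h' :
  spanX (fun hs1 aa1 e' =>
    [/\ size hs1 = size hs, (size aa1).+2 = size l & exists a, e' = a # h'])
  (d0_body w a0 h0 hs l h').
Proof.
apply: kspanD.
  case: l => [|a t]; first exact: kspan0.
  apply: tlift_kspan => x y; apply: swl_kspan => u v _ szv.
  apply: spanX_mono (mkX_span _ _ _ _ _) => hs1 aa1 e' [-> szt ?].
  by rewrite /= -szt.
apply: kspan_sum => i _ _; apply: kspanZ.
apply: spanX_mono (mkX_span _ _ _ _ _) => hs1 aa1 e' [-> -> ?]; split=> //.
by apply: size_merge_at; case: i => /= i; lia.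
Qed.

Lemma d0_span e hs aa e' :
  spanX (fun hs1 aa1 e1 => [/\ size hs1 = size hs, (size aa1).+1 = size aa
    & in_base e' -> in_base e1]) (d0 w (genX e hs aa e')).
Proof.
rewrite d0E /d0_word; apply: cplift_kspan => a0 h0.
have bl : bilin (fun a' h' => d0_body w a0 h0 hs (rcons aa a') h').
  split=> [h|a]; last exact: lin_d0_body_h'.
  by apply: lin_ext (mlin_d0_body_a w a0 h0 hs h aa [::]) => z; rewrite cats1.
have [[a e'E]|nb] := pselect (in_base e').
  rewrite e'E cpliftE //; apply: spanX_mono (d0_body_span _ _ _ _ _).
  move=> hs1 aa1 e1 []; rewrite size_rcons => -> [->] [b ->]; split=> // _.
  by exists b.
apply: cplift_kspan => a' h'; apply: spanX_mono (d0_body_span _ _ _ _ _).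
by move=> hs1 aa1 e1 []; rewrite size_rcons => -> [->].
Qed.

Lemma homog_d0 : homog 0 (d0 w).
Proof.
split=> [|e hs aa e']; first exact: lin_d0.
by apply: spanX_mono (d0_span _ _ _ _) => hs1 aa1 e1 [-> ->]; rewrite !addn0.
Qed.

Definition spanY (P : seq H -> H -> Prop) : Y -> Prop :=
  kspan (fun y => exists e hs h', P hs h' /\ y = genY e hs h').

Lemma spanY_gen (P : seq H -> H -> Prop) e hs h' :
  P hs h' -> spanY P (genY e hs h').
Proof. by move=> Pw; apply: kspan_mem; exists e, hs, h'. Qed.

Lemma spanY_lin (M : lmodType k) (P : seq H -> H -> Prop)
    (G : M -> Prop) (L : Y -> M) x : lin L ->
  (forall e hs h', P hs h' -> kspan G (L (genY e hs h'))) ->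
  spanY P x -> kspan G (L x).
Proof. by move=> Ll LG; apply: kspan_lin => // _ [e [hs [h' [/LG + ->]]]]. Qed.

Lemma mu_span e hs aa e' :
  spanY (fun hs1 h1 => [/\ size hs1 = size hs, size aa = 0%N
    & in_base e' -> h1 = 1]) (mu w (genX e hs aa e')).
Proof.
rewrite muE; case: aa => [|? ?]; last exact: kspan0.
apply: cplift_kspan => a0 h0.
have bl : bilin (fun a1 h' => sw2 h0 (fun x y => swl hs (fun u v =>
    genY ((a0 * wactl w (x :: u) a1) # y) v h' : Y))).
  lin_tac; last exact: (multilinY_r multilin_genY).
  by apply: (lin_comp (multilinY_l multilin_genY _ _)); lin_tac.
have [[a e'E]|nb] := pselect (in_base e').
  rewrite e'E cpliftE //; apply: tlift_kspan => x y.
  by apply: swl_kspan => u v _ szv; apply: spanY_gen.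
apply: cplift_kspan => a' h'; apply: tlift_kspan => x y.
by apply: swl_kspan => u v _ szv; apply: spanY_gen.
Qed.

Lemma partial_span e hs h' :
  spanY (fun hs1 _ => (size hs1).+1 = size hs) (partial w f (genY e hs h')).
Proof.
rewrite (partialE crossed) /partial_word; apply: cplift_kspan => a h0.
apply: kspan_sum => -[i /= lt_i] _ _; apply: kspanZ; apply: swl_kspan => u v szu szv.
apply: tlift_kspan => x x'; apply: tlift_kspan => y y'.
have szE : size (v ++ (x' * y') :: drop i.+2 (h0 :: rcons hs h')) = (size hs).+1.
  rewrite size_cat /= szv size_take size_drop /= size_rcons ifT; lia.
case: (v ++ _) szE => [//|b t]; case/lastP: t => [_|t c]; first exact: kspan0.
by rewrite mkY_rcons /= size_rcons => -[szt]; apply: spanY_gen.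
Qed.

Lemma homog_d1 : homog 1 (fun x => - sigma0Y (partial w f (mu w x))).
Proof.
apply: homog_opp; split.
  apply: (lin_comp (@lin_sigma0Y k H A) (lin_comp (lin_partial crossed) (lin_mu w))).
move=> e hs aa e'; move: (mu_span e hs aa e').
apply: (spanY_lin (lin_comp (@lin_sigma0Y k H A) (lin_partial crossed))).
move=> e1 hs1 h1 [szh aa0 _]; move: (partial_span e1 hs1 h1).
apply: spanY_lin => [|e2 hs2 h2 szh2]; first exact: lin_sigma0Y.
rewrite sigma0YE; apply: spanX_gen => /=; lia.
Qed.

End Homogeneity.

(** * The differentials d^l, the maps sigma^l and the contracting homotopy *)

Section PerturbedMaps.
Context (k : comNzRingType) (H : hopfAlgebra k) (A : algType k).
Context (w : weakAction H A) (f : {linear tensor H H -> A}).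
Hypothesis crossed : is_crossed_product w f.
Local Notation E := (cprod H A).
Local Notation X := (X H A).
Local Notation Y := (Y H A).
Local Notation B := (B H A).
Local Notation "1E" := (cone H A).
Local Notation cmul := (cmul w f).

Definition dgen_core (l : nat) (dprev : nat -> X -> X) (r : nat) (x : X) : X :=
  match r with
  | 0 => if l == 1%N then - sigma0Y (partial w f (mu w x))
         else - \sum_(1 <= j < l) sigma0X (dprev (l - j)%N (dprev j x))
  | r'.+1 => - (sigma0X (dgen w f l dprev r' (d0 w x))
               + \sum_(1 <= j < l) sigma0X (dprev (l - j)%N (dprev j x)))
  end.

Lemma dgenE l dprev r : dgen w f l dprev r = extX (fun e hs aa e' =>
  if (size aa == r) && (l <= size hs)%N
  then lmulX w f e (rmulX w f (dgen_core l dprev r (genX 1E hs aa 1E)) e')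
  else 0).
Proof. by case: r. Qed.

(** The locality required by [srecE]: both j and l - j stay below l in the sums. *)
Lemma eq_dgen l u v r :
  (forall j, (j < l)%N -> u j = v j) -> dgen w f l u r = dgen w f l v r.
Proof.
move=> uv.
have uvS x : \sum_(1 <= j < l) sigma0X (u (l - j)%N (u j x)) =
             \sum_(1 <= j < l) sigma0X (v (l - j)%N (v j x)).
  by apply: eq_big_nat => j /andP[j0 jl]; rewrite !uv //; lia.
elim: r => [|r IHr]; rewrite !dgenE; congr extX; apply/funext => e;
  apply/funext => hs; apply/funext => aa; apply/funext => e';
  case: ifP => // _; congr (lmulX _ _ _ (rmulX _ _ _ _)); rewrite /dgen_core uvS //.
by rewrite IHr.
Qed.

(** Induction on r for fixed l: the term j = 0 of the recursion uses d^l again, but on [d0 x], where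
    r is one smaller. *)
Lemma homog_dgen l dprev r : (0 < l)%N ->
  (forall j, (0 < j < l)%N -> homog j (dprev j)) -> homog l (dgen w f l dprev r).
Proof.
move=> l0 dP.
have dS : homog l (fun x =>
    \sum_(1 <= j < l) sigma0X (dprev (l - j)%N (dprev j x))).
  apply: homog_sum => j; rewrite mem_index_iota => /andP[j0 jl] _.
  rewrite -{1}(subnK (ltnW jl)); apply: homog_comp; apply: dP; lia.
have core r' : homog l (dgen_core l dprev r') -> homog l (dgen w f l dprev r').
  case=> Ll LP.
  have ml := multilinX_bimod w f (fun s r1 => (r1 == r') && (l <= s)%N) Ll.
  rewrite dgenE; split=> [|e hs aa e']; first exact: lin_extX ml.
  rewrite (extXE ml); case: ifP => _; last exact: kspan0.
  move: (LP 1E hs aa 1E).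
  apply: (spanX_lin (lin_comp (lin_lmulX w f e) (lin_rmulX w f e'))).
  by move=> *; rewrite rmulXE lmulXE; apply: spanX_gen.
elim: r => [|r IHr]; apply: core; rewrite /dgen_core.
  case: eqP => [->|_]; [exact: homog_d1 | exact: homog_opp].
apply/homog_opp/homog_add => //.
by have := homog_comp IHr (homog_d0 w); rewrite addn0.
Qed.

Lemma dl_rec l : (0 < l)%N -> dl w f l = extX (fun e hs aa e' =>
  dgen w f l (dl w f) (size aa) (genX e hs aa e')).
Proof.
move=> l0; rewrite /dl srecE => [|u v uv]; first by rewrite -[l]prednK.
case: eqP => // _; congr extX; apply/funext => e; apply/funext => hs.
by apply/funext => aa; apply/funext => e'; rewrite (eq_dgen _ uv).
Qed.

Lemma homog_dl l : homog l (dl w f l).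
Proof.
elim/ltn_ind: l => -[_|l IHl]; first exact: homog_d0.
have dgP r : homog l.+1 (dgen w f l.+1 (dl w f) r).
  by apply: homog_dgen => // j /andP[_ jl]; apply: IHl.
have ml := multilinX_genX (L := fun _ r => dgen w f l.+1 (dl w f) r)
  (fun _ r => proj1 (dgP r)).
rewrite dl_rec //; split=> [|e hs aa e']; first exact: (lin_extX ml).
by rewrite (extXE ml); case: (dgP (size aa)).
Qed.

Lemma sigma_nextE (V : Type) (sigma0 : V -> X) l v : (0 < l)%N ->
  sigma_next w f sigma0 l v =
  - \sum_(i < l) sigma0X (dl w f (l - i)%N (sigma_next w f sigma0 i v)).
Proof.
move=> l0; rewrite {1}/sigma_next srecE => [|s t st]; first by rewrite -[l]prednK.
case: eqP => // _; apply/funext => x; congr (- _).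
by apply: eq_bigr => i _; rewrite st.
Qed.

Lemma lin_sigma_next (V : lmodType k) (sigma0 : V -> X) l :
  lin sigma0 -> lin (sigma_next w f sigma0 l).
Proof.
move=> sl; elim/ltn_ind: l => -[_ //|l IHl].
apply: lin_ext => [v|]; first exact: sigma_nextE.
apply/lin_opp/lin_sum => i _; have [dlin _] := homog_dl (l.+1 - i).
by apply: (lin_comp (@lin_sigma0X k H A)); apply: (lin_comp dlin); apply: IHl.
Qed.

Lemma sigma_next_span (V : lmodType k) (sigma0 : V -> X) l v r s :
  spanX (fun hs aa _ => size hs = s /\ size aa = r) (sigma0 v) ->
  spanX (fun hs aa _ => (size hs + l)%N = s /\ size aa = (r + l)%N)
    (sigma_next w f sigma0 l v).
Proof.
move=> s0P; elim/ltn_ind: l => -[_|l IHl].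
  by apply: spanX_mono s0P => hs aa _ [<- <-]; rewrite !addn0.
rewrite sigma_nextE //; apply/kspanN/kspan_sum => -[i /= il] _ _.
have [dlin dP] := homog_dl (l.+1 - i); move: (IHl i il).
apply: (spanX_lin (lin_comp (@lin_sigma0X k H A) dlin)).
move=> e hs aa e' [szh sza]; move: (sigma0X_span (dP e hs aa e')).
apply: spanX_mono => hs1 aa1 e1 [t [e2 [[szh1 szt] sza1 _]]]; lia.
Qed.

Definition fil (i n : nat) (hs : seq H) (aa : seq A) (_ : E) : Prop :=
  (size hs + size aa)%N = n /\ (size hs <= i)%N.

(* The part of F^i(X_n) whose component in filtration degree exactly [i] has
   its last factor in A; it lies between F^(i-1)(X_n) and F^i(X_n). *)
Definition filA (i n : nat) (hs : seq H) (aa : seq A) (e' : E) : Prop :=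
  fil i n hs aa e' /\ (size hs = i -> in_base e').

Lemma multilin_d : multilinX (fun e hs aa e' =>
  \sum_(l < (size hs).+1 | (0 < size aa + l)%N) dl w f l (genX e hs aa e')).
Proof.
apply: (multilinX_genX (L := fun s r x =>
  \sum_(l < s.+1 | (0 < r + l)%N) dl w f l x)) => s r.
by apply: lin_sum => l _; case: (homog_dl l).
Qed.

Lemma lin_d : lin (d w f). Proof. exact: lin_extX multilin_d. Qed.

Lemma d_span n e hs aa e' : (size hs + size aa)%N = n.+1 -> in_base e' ->
  spanX (filA (size hs) n) (d w f (genX e hs aa e')).
Proof.
move=> szw be; rewrite [d _ _ _](extXE multilin_d); apply: kspan_sum => -[[|l] /= lt_l] _ rl.
  apply: spanX_mono (d0_span w e hs aa e') => hs1 aa1 e1 [szh sza /(_ be) ?].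
  by split=> //; split; lia.
have [_ dP] := homog_dl l.+1; apply: spanX_mono (dP e hs aa e').
by move=> hs1 aa1 e1 [szh sza]; split=> [|?]; [split|]; lia.
Qed.

Lemma multilin_sigmabar : multilinX (fun e hs aa e' =>
  let x := genX e hs aa e' in let n := (size hs + size aa)%N in
  - \sum_(l < n.+2) sigmaY w f l (sigmam1 (mu w x))
  + \sum_(l < (size hs).+1) sigmaX w f l x).
Proof.
apply: (multilinX_genX (L := fun s r x =>
  - \sum_(l < (s + r).+2) sigmaY w f l (sigmam1 (mu w x))
  + \sum_(l < s.+1) sigmaX w f l x)) => s r.
apply: lin_add.
  apply/lin_opp/lin_sum => l _.
  apply: (lin_comp (lin_sigma_next l (@lin_sigma0Y k H A))).
  exact: (lin_comp (@lin_sigmam1 k H A) (lin_mu w)).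
by apply: lin_sum => l _; apply/lin_sigma_next/lin_sigma0X.
Qed.

Lemma lin_sigmabar : lin (sigmabar w f). Proof. exact: lin_extX multilin_sigmabar. Qed.

(** For l = 0 the number of H-entries is kept and a last factor in A becomes 1. For l > 0 that
    number drops below i, which makes the clause on the last factor vacuous. *)
Lemma sigmaX_span i n l e hs aa e' : filA i n hs aa e' ->
  spanX (filA i n.+1) (sigmaX w f l (genX e hs aa e')).
Proof.
move=> [[szw szh] be]; have xP : spanX (fun hs1 aa1 e1 =>
    [/\ hs1 = hs, aa1 = aa & e1 = e']) (genX e hs aa e').
  exact: spanX_gen.
case: l => [|l].
  apply: spanX_mono (sigma0X_span xP) => hs1 aa1 e1 [t [e2 [[-> -> ->] sza be1]]].
  by split=> [|/be/be1 //]; split=> //; lia.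
have s0P : spanX (fun hs1 aa1 _ => size hs1 = size hs /\ size aa1 = (size aa).+1)
    (sigma0X (genX e hs aa e')).
  by apply: spanX_mono (sigma0X_span xP) => hs1 aa1 e1 [t [e2 [[-> -> _] -> _]]].
apply: spanX_mono (sigma_next_span l.+1 s0P) => hs1 aa1 e1 [szh1 sza1].
by split=> [|?]; [split|]; lia.
Qed.

Lemma sigmaY_span i n l e hs aa e' : filA i n hs aa e' ->
  spanX (filA i n.+1) (sigmaY w f l (sigmam1 (mu w (genX e hs aa e')))).
Proof.
move=> [[szw szh] be]; move: (mu_span w e hs aa e').
apply: (spanY_lin (lin_comp (lin_sigma_next l (@lin_sigma0Y k H A))
  (@lin_sigmam1 k H A))) => e1 hs1 h1 [szh1 aa0 h11].
have sl := lin_sigma_next l (@lin_sigma0Y k H A).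
have [eq_i|ne_i] := eqVneq (size hs) i.
  rewrite sigmam1E h11; last exact: be.
  rewrite -cats1 (multilinY_h1 multilin_genY) scaler0 (lin0 sl).
  exact: kspan0.
(* Below degree i there is room for the H-entry added by sigma^(-1): the new word has at most i of
   them. *)
rewrite sigmam1E -[_ *: _]addr0 sl (lin0 sl) addr0; apply: kspanZ.
have szr : size (rcons hs1 h1) = (size hs).+1 by rewrite size_rcons szh1.
case: l {sl} => [|l].
  change (spanX (filA i n.+1) (sigma0Y (genY e1 (rcons hs1 h1) 1))).
  rewrite sigma0YE; apply: spanX_gen; split=> [|_].
    by split=> /=; lia.
  exact: in_base1.
have s0P : spanX (fun hs1 aa1 _ => size hs1 = (size hs).+1 /\ size aa1 = 0%N)
    (sigma0Y (genY e1 (rcons hs1 h1) 1)).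
  by rewrite sigma0YE; apply: spanX_gen.
apply: spanX_mono (sigma_next_span l.+1 s0P) => hs2 aa2 e2 [szh2 sza2].
by split=> [|?]; [split|]; lia.
Qed.

Lemma sigmabar_span i n x :
  spanX (filA i n) x -> spanX (filA i n.+1) (sigmabar w f x).
Proof.
apply: spanX_lin => [|e hs aa e' xP]; first exact: lin_sigmabar.
rewrite [sigmabar _ _ _](extXE multilin_sigmabar); apply: kspanD.
  by apply/kspanN/kspan_sum => l _ _; apply: sigmaY_span.
by apply: kspan_sum => l _ _; apply: sigmaX_span.
Qed.
End PerturbedMaps.

(** * The comparison maps phi and psi, and the homotopy omega *)

Section Comparison.
Context (k : comNzRingType) (H : hopfAlgebra k) (A : algType k).
Context (w : weakAction H A) (f : {linear tensor H H -> A}).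
Hypothesis crossed : is_crossed_product w f.
Local Notation E := (cprod H A).
Local Notation X := (X H A).
Local Notation Y := (Y H A).
Local Notation B := (B H A).
Local Notation "1E" := (cone H A).
Local Notation cmul := (cmul w f).

Local Notation cnt := (count (fun e : E => `[< in_base e >])).

Definition spanB (P : seq E -> E -> Prop) : B -> Prop :=
  kspan (fun x => exists e es e', P es e' /\ x = genB e es e').

Lemma spanB_gen (P : seq E -> E -> Prop) e es e' :
  P es e' -> spanB P (genB e es e').
Proof. by move=> Pw; apply: kspan_mem; exists e, es, e'. Qed.

Lemma spanB_lin (M : lmodType k) (P : seq E -> E -> Prop)
    (G : M -> Prop) (L : B -> M) x : lin L ->
  (forall e es e', P es e' -> kspan G (L (genB e es e'))) ->
  spanB P x -> kspan G (L x).
Proof. by move=> Ll LG; apply: kspan_lin => // _ [e [es [e' [/LG + ->]]]]. Qed.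

Lemma spanB_mono (P Q : seq E -> E -> Prop) x :
  (forall es e', P es e' -> Q es e') -> spanB P x -> spanB Q x.
Proof. by move=> PQ; apply: spanB_lin => // e es e' /PQ; apply: spanB_gen. Qed.

Definition bfil (i n : nat) (es : seq E) (_ : E) : Prop :=
  size es = n /\ (n - i <= cnt es)%N.

(** This is the condition [bfil i n.+1] on [rcons es e'], the list of inner factors that [xi]
    produces. *)
Definition bfilA (i n : nat) (es : seq E) (e' : E) : Prop :=
  size es = n /\ (n.+1 - i <= cnt (rcons es e'))%N.

Lemma cnt_rcons es e' : cnt (rcons es e') = (cnt es + `[< in_base e' >])%N.
Proof. by rewrite -cats1 count_cat /= addn0. Qed.

(** Splitting according to the last factor reduces the refined filtration to F^i and F^(i-1), where
    statements about words of [bfil] can be applied. *)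
Lemma bfilAP i n es e' : bfilA i n es e' ->
  bfil i n es e' /\ in_base e' \/ (0 < i)%N /\ bfil i.-1 n es e'.
Proof.
case=> szes; rewrite cnt_rcons; case: asboolP => [be|_] ce.
  by left; split=> //; split=> //; lia.
have := count_size (fun e : E => `[< in_base e >]) es.
(* For i = 0 all n + 1 counted factors would have to be in A, contrary to the last one being
   outside. *)
by case: i ce => [|i] ce le_c; [lia | right; split=> //; split=> //=; lia].
Qed.

Lemma bfilA_base i n es e' : bfil i n es e' -> in_base e' -> bfilA i n es e'.
Proof.
by case=> szes ce be; split; rewrite // cnt_rcons asboolT //= ; lia.
Qed.

Lemma bfilA_pred i n es e' : (0 < i)%N -> bfil i.-1 n es e' -> bfilA i n es e'.
Proof. by move=> i0 [szes ce]; split; rewrite // cnt_rcons; lia. Qed.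

Lemma xi_span i n x : spanB (bfilA i n) x ->
  spanB (fun es e' => bfil i n.+1 es e' /\ e' = 1E) (xi x).
Proof.
apply: spanB_lin => [|e es e' [szes ce]]; first exact: lin_xi.
rewrite xiE; apply/kspanZ/spanB_gen; split=> //.
by split; rewrite ?size_rcons ?szes.
Qed.

(** Two entries in A merge to one in A, because A is closed under the product; in all other cases
    the merged pair contained at most one entry of A. *)
Lemma cnt_merge_at i l : (i.+1 < size l)%N ->
  (cnt l <= (cnt (merge_at cmul 0%R i l)).+1)%N.
Proof.
move=> lt_i; rewrite -{1}(cat_take_drop i l) (drop_nth 0 (ltnW lt_i)).
rewrite (drop_nth 0 lt_i) /merge_at !count_cat /=.
have := @in_base_mul _ _ _ w f l`_i l`_i.+1.
case: asboolP => [bx|_] bM /=; last by do 2 case: asboolP => _ /=; lia.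
case: (asboolP (in_base l`_i.+1)) => [by_|_] /=; last by case: asboolP => _ /=; lia.
by rewrite (asboolT (bM bx by_)) /=; lia.
Qed.

Lemma bprime_span i n e es : bfil i n.+1 es 1E ->
  spanB (bfilA i n) (bprime w f (genB e es 1E)).
Proof.
case=> szes ce; rewrite (bprimeE crossed) /bprime_word.
apply: kspan_sum => -[j /= lt_j] _ _; apply: kspanZ.
set l := rcons es 1E.
have szl : size l = n.+2 by rewrite size_rcons szes.
have cl : (n.+2 - i <= cnt l)%N.
  by rewrite cnt_rcons asboolT; [rewrite /=; lia | exact: in_base1].
have gen e0 (l' : seq E) : size l' = n.+1 -> (n.+1 - i <= cnt l')%N ->
    spanB (bfilA i n) (mkB (e0 :: l')).
  case/lastP: l' => // es' e' szl' cl'; rewrite mkB_rcons; apply: spanB_gen.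
  by split=> //; move: szl'; rewrite size_rcons => -[].
(* The first merge absorbs x_1 into the uncounted left factor and so loses at most one entry of A.
   All other merges happen inside the counted list [l]. *)
case: j lt_j => [|j] lt_j.
  rewrite [adj _ _ _](_ : _ = mkB (cmul e l`_0 :: behead l)); last first.
    by rewrite /adj /= drop1.
  apply: gen; first by rewrite size_behead szl.
  by case: (l) szl cl => //= x l' _; case: asboolP => _; lia.
apply: (gen e (merge_at cmul 0 j l)).
  by apply/eq_add_S; rewrite size_merge_at // szl; lia.
have := @cnt_merge_at j l; rewrite szl; lia.
Qed.

Lemma multilin_phi0 : multilinX (fun e hs aa e' =>
  if (size hs + size aa == 0)%N then genB e [::] e' else 0 : B).
Proof.
case: (@multilin_genB k H A) => gl gr gi g1; split.
- by move=> hs aa e'; apply: lin_if (gl _ _).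
- by move=> e hs aa; apply: lin_if (gr _ _).
- move=> e aa e' u v; apply: lin_ext (@lin_cst0 _ _ _) => z.
  by rewrite size_cat_cons.
- move=> e hs e' u v; apply: lin_ext (@lin_cst0 _ _ _) => z.
  by rewrite size_cat_cons addnS.
- by move=> e u v aa e'; rewrite size_cat_cons.
- by move=> e hs u v e'; rewrite size_cat_cons addnS.
Qed.

Lemma multilin_psi0 : multilinB (fun e es e' =>
  if size es == 0%N then genX e [::] [::] e' else 0 : X).
Proof.
case: (@multilin_genX k H A) => gl gr gh ga gh1 ga1; split.
- by move=> es e'; apply: lin_if (gl _ _ _).
- by move=> e es; apply: lin_if (gr _ _ _).
- move=> e e' u v; apply: lin_ext (@lin_cst0 _ _ _) => z.
  by rewrite size_cat_cons.
- by move=> e u v e'; rewrite size_cat_cons.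
Qed.

Lemma multilin_phiS n : lin (phi w f n) -> multilinX (fun e hs aa e' =>
  if (size hs + size aa == n.+1)%N then
    rmulB w f (xi (phi w f n (d w f (genX e hs aa 1E)))) e' else 0).
Proof.
move=> pl; apply: (multilinX_right (fun s r => s + r == n.+1)%N
  (L := fun x => xi (phi w f n (d w f x))) (R := rmulB w f)).
- exact: (lin_comp (@lin_xi k H A) (lin_comp pl (lin_d crossed))).
- exact: lin_rmulB.
- exact: lin_rmulBr.
Qed.

Lemma lin_phi n : lin (phi w f n).
Proof.
elim: n => [|n IHn]; first exact: lin_extX multilin_phi0.
exact: lin_extX (multilin_phiS IHn).
Qed.

(** The word estimate is a hypothesis here because this statement is used inside the induction that
    proves it. Words of exact degree i keep their last factor, hence land in F^i with last factor in
    A; words of smaller degree land in F^(i-1). *)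
Lemma phi_span_of n i x :
  (forall e hs aa e', (size hs + size aa)%N = n ->
    spanB (fun es e1 => bfil (size hs) n es e1 /\ e1 = e')
      (phi w f n (genX e hs aa e'))) ->
  spanX (filA i n) x -> spanB (bfilA i n) (phi w f n x).
Proof.
move=> phiP; apply: spanX_lin => [|e hs aa e' [[szw szh] be]].
  exact: lin_phi.
apply: spanB_mono (phiP e hs aa e' szw) => es e1 [[szes ce] e1E].
have [eq_i|ne_i] := eqVneq (size hs) i.
  apply: bfilA_base; first by rewrite -eq_i.
  by rewrite e1E; apply: be.
by apply: bfilA_pred; [|split=> //]; lia.
Qed.

Lemma phi_span n e hs aa e' : (size hs + size aa)%N = n ->
  spanB (fun es e1 => bfil (size hs) n es e1 /\ e1 = e')
    (phi w f n (genX e hs aa e')).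
Proof.
elim: n e hs aa e' => [|n IHn] e hs aa e' szw.
  rewrite [phi _ _ _ _](extXE multilin_phi0) szw eqxx.
  by apply: spanB_gen; split.
rewrite [phi _ _ _ _](extXE (multilin_phiS (lin_phi n))) szw eqxx.
have := d_span crossed e szw (@in_base1 k H A).
move/(phi_span_of IHn)/xi_span; apply: (spanB_lin (lin_rmulB w f e')).
move=> e1 es1 e1' [[szes ce] ->]; rewrite /= rmulBE (cmul1e crossed).
by apply: spanB_gen; split.
Qed.

Lemma phi_filA n i x :
  spanX (filA i n) x -> spanB (bfilA i n) (phi w f n x).
Proof. by apply: phi_span_of => *; apply: phi_span. Qed.

Lemma multilin_psiS n : lin (psi w f n) -> multilinB (fun e es e' =>
  if size es == n.+1 then
    rmulX w f (sigmabar w f (psi w f n (bprime w f (genB e es 1E)))) e' else 0).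
Proof.
move=> pl; apply: (multilinB_right (fun s => s == n.+1)
  (L := fun x => sigmabar w f (psi w f n (bprime w f x))) (R := rmulX w f)).
- exact: (lin_comp (lin_sigmabar crossed) (lin_comp pl (lin_bprime crossed))).
- exact: lin_rmulX.
- exact: lin_rmulXr.
Qed.

Lemma lin_psi n : lin (psi w f n).
Proof.
elim: n => [|n IHn]; first exact: lin_extB multilin_psi0.
exact: lin_extB (multilin_psiS IHn).
Qed.

Lemma psi_span_of n i x :
  (forall i e es e', bfil i n es e' ->
    spanX (fun hs aa e1 => fil i n hs aa e1 /\
      (size hs = i -> in_base e' -> in_base e1)) (psi w f n (genB e es e'))) ->
  spanB (bfilA i n) x -> spanX (filA i n) (psi w f n x).
Proof.
move=> psiP; apply: spanB_lin => [|e es e' /bfilAP[[xP be]|[i0 xP]]].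
- exact: lin_psi.
- apply: spanX_mono (psiP i e es e' xP) => hs aa e1 [fP bP].
  by split=> // /bP; apply.
- apply: spanX_mono (psiP i.-1 e es e' xP) => hs aa e1 [[szw szh] _].
  by split=> [|?]; [split|]; lia.
Qed.

(** The clause on last factors makes the induction close. The homotopy yields words of exact degree
    i with last factor in A, and multiplying by e' in A stays in A. *)
Lemma psi_span n i e es e' : bfil i n es e' ->
  spanX (fun hs aa e1 => fil i n hs aa e1 /\
    (size hs = i -> in_base e' -> in_base e1)) (psi w f n (genB e es e')).
Proof.
elim: n i e es e' => [|n IHn] i e es e' [szes ce].
  rewrite [psi _ _ _ _](extBE multilin_psi0) szes eqxx.
  by apply: spanX_gen; split.
rewrite [psi _ _ _ _](extBE (multilin_psiS (lin_psi n))) szes eqxx.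
have := @bprime_span i n e es (conj szes ce).
move/(psi_span_of IHn)/(sigmabar_span crossed).
apply: (spanX_lin (lin_rmulX w f e')).
move=> e1 hs aa e1' [fP bP]; rewrite /= rmulXE; apply: spanX_gen; split=> // /bP.
exact: in_base_mul.
Qed.

Lemma psi_filA n i x :
  spanB (bfilA i n) x -> spanX (filA i n) (psi w f n x).
Proof. by apply: psi_span_of => *; apply: psi_span. Qed.

Lemma multilin_omegaS n : lin (omega w f n.+1) -> multilinB (fun e es e' =>
  if size es == n.+1 then
    let z := genB e es 1E in
    rmulB w f (xi (phi w f n.+1 (psi w f n.+1 z) - z
                   - omega w f n.+1 (bprime w f z))) e'
  else 0).
Proof.
move=> ol; apply: (multilinB_right (fun s => s == n.+1)
  (L := fun z => xi (phi w f n.+1 (psi w f n.+1 z) - z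
                   - omega w f n.+1 (bprime w f z))) (R := rmulB w f)).
- apply: (lin_comp (@lin_xi k H A)); apply: lin_add.
    apply: lin_add; last exact: lin_opp.
    exact: (lin_comp (lin_phi n.+1) (lin_psi n.+1)).
  exact: lin_opp (lin_comp ol (lin_bprime crossed)).
- exact: lin_rmulB.
- exact: lin_rmulBr.
Qed.

Lemma lin_omega n : lin (omega w f n).
Proof.
case: n => [|n]; first exact: lin_cst0.
elim: n => [|n IHn]; first exact: lin_cst0.
exact: lin_extB (multilin_omegaS IHn).
Qed.

Lemma omega_span n i e es e' : bfil i n es e' ->
  spanB (fun es1 e1 => bfil i n.+1 es1 e1 /\ e1 = e')
    (omega w f n.+1 (genB e es e')).
Proof.
elim: n i e es e' => [|n IHn] i e es e' [szes ce]; first exact: kspan0.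
rewrite [omega _ _ _ _](extBE (multilin_omegaS (lin_omega n.+1))) szes eqxx.
have zP : spanB (bfilA i n.+1) (genB e es 1E).
  by apply: spanB_gen; apply: bfilA_base (@in_base1 k H A).
(* The induction hypothesis preserves last factors, so it carries both alternatives of [bfilAP] to
   degree n + 1. *)
have oP x : spanB (bfilA i n) x -> spanB (bfilA i n.+1) (omega w f n.+1 x).
  apply: spanB_lin => [|e1 es1 e1' /bfilAP[[xP be]|[i0 xP]]].
  - exact: lin_omega.
  - apply: spanB_mono (IHn i e1 es1 e1' xP) => es2 e2 [fP e2E].
    by apply: bfilA_base; rewrite ?e2E in fP *.
  - apply: spanB_mono (IHn i.-1 e1 es1 e1' xP) => es2 e2 [fP _].
    exact: bfilA_pred.
have : spanB (bfilA i n.+1) (phi w f n.+1 (psi w f n.+1 (genB e es 1E))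
    - genB e es 1E - omega w f n.+1 (bprime w f (genB e es 1E))).
  apply: kspanD; last by apply/kspanN/oP/bprime_span.
  by apply: kspanD; [apply/phi_filA/psi_filA | apply: kspanN].
move/xi_span; apply: (spanB_lin (lin_rmulB w f e')).
move=> e1 es1 e1' [[szes1 ce1] ->]; rewrite /= rmulBE (cmul1e crossed).
by apply: spanB_gen; split.
Qed.

(** The word is e (1 (x) x_1 (x) ... (x) x_n (x) 1) e', by the two unit laws of E. *)
Lemma filB_gen i n e es e' : bfil i n es e' -> filB w f i n (genB e es e').
Proof.
case=> szes ce.
have -> : genB e es e' = rmulB w f (lmulB w f e (genB 1E es 1E)) e'.
  by rewrite lmulBE rmulBE (cmule1 crossed) (cmul1e crossed).
by apply/subbimodr/subbimodl/subbimod_gen; exists es.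
Qed.

(** Words with arbitrary outer factors are permuted by the two multiplications, so their k-span is
    already a sub-bimodule. It then suffices to check each inclusion on words. *)
Lemma filB_span i n x : filB w f i n x <-> spanB (bfil i n) x.
Proof.
split; last first.
  elim=> [|c _ y [e [es [e' [eP ->]]]] _ IH]; first exact: subbimod0.
  apply: subbimodD => //.
  have gl := multilinB_l (@multilin_genB k H A) es e'.
  rewrite -[c *: _]addr0 -(lin0 gl) -gl; exact: filB_gen.
elim=> [_ [es [szes ce ->]]||y z _ IHy _ IHz|c y _ IHy|c y _ IHy].
- exact: spanB_gen.
- exact: kspan0.
- exact: kspanD.
- move: IHy; apply: (spanB_lin (lin_lmulB w f c)).
  by move=> e es e' eP; rewrite /= lmulBE; apply: spanB_gen.
- move: IHy; apply: (spanB_lin (lin_rmulB w f c)).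
  by move=> e es e' eP; rewrite /= rmulBE; apply: spanB_gen.
Qed.

Lemma filX_span i n (x : X) : filX i n x <-> spanX (@fil k H A i n) x.
Proof.
split; apply: kspan_mono => y [e [hs [aa [e' yP]]]]; exists e, hs, aa, e'.
  by case: yP.
by case: yP => -[].
Qed.

End Comparison.

Theorem proposition1p2p2 (k : comNzRingType) (H : hopfAlgebra k) (A : algType k)
    (w : weakAction H A) (f : {linear tensor H H -> A})
    (crossed : is_crossed_product w f) (i n : nat) :
  [/\ forall x : X H A, filX i n x -> filB w f i n (phi w f n x),
      forall y : B H A, filB w f i n y -> filX i n (psi w f n y)
    & forall y : B H A, filB w f i n y -> filB w f i n.+1 (omega w f n.+1 y)].
Proof.
split=> x.
- move=> /filX_span xP; apply/(filB_span crossed); move: xP.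
  apply: spanX_lin => [|e hs aa e' [szw szh]]; first exact: lin_phi.
  apply: spanB_mono (phi_span crossed e e' szw) => es e1 [[szes ce] _].
  by split=> //; apply: leq_trans ce; apply: leq_sub2l.
- move=> /(filB_span crossed) xP; apply/filX_span; move: xP.
  apply: spanB_lin => [|e es e' eP]; first exact: lin_psi.
  by apply: spanX_mono (psi_span crossed e eP) => hs aa e1 [].
- move=> /(filB_span crossed) xP; apply/(filB_span crossed); move: xP.
  apply: spanB_lin => [|e es e' eP]; first exact: lin_omega.
  by apply: spanB_mono (omega_span crossed e eP) => es1 e1 [].
Qed.
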